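(* Let $F_2$ be the free group of rank $2$ and let $\alpha_2,\beta_2\colon\mathbb{N}\to\mathbb{N}$ be its gap functions for automorphism inversion and outer automorphism inversion (with respect to a fixed free basis). Then: (i) for $n\geqslant 4$, $\alpha_2(n)\leqslant \frac{(n-1)^2}{2}$; (ii) for $n\geqslant 10$, $\frac{n^2}{4}-6n+42\leqslant \alpha_2(n)$; (iii) for $n\geqslant 0$, $\beta_2(n)=n$.
   Context: Fix a free basis $a_1,\dots,a_r$ of the free group $F_r$ (here $r=2$). For $w\in F_r$, $|w|$ is the length of the reduced word in $a_1^{\pm1},\dots,a_r^{\pm1}$ representing $w$. Automorphisms act on the right. For $\varphi\in \mathrm{Aut}(F_r)$ put $\|\varphi\|=|a_1\varphi|+\cdots+|a_r\varphi|$. For $g\in F_r$ let $\lambda_g$ be the inner automorphism $x\mapsto g^{-1}xg$, let $\Lambda=\{\lambda_g\mid g\in F_r\}$ and $\mathrm{Out}(F_r)=\mathrm{Aut}(F_r)/\Lambda$, whose elements are the cosets $[\varphi]=\varphi\Lambda$. For $\Phi\in\mathrm{Out}(F_r)$ put $\|\Phi\|=\min\{\|\varphi\| \mid \varphi\in\Phi\}$. For $n\in\mathbb{N}=\{0,1,2,\dots\}$ define $$\alpha_r(n)=\max\{\|\varphi^{-1}\| \mid \varphi\in\mathrm{Aut}(F_r),\ \|\varphi\|\leqslant n\},\qquad \beta_r(n)=\max\{\|\Phi^{-1}\| \mid \Phi\in\mathrm{Out}(F_r),\ \|\Phi\|\leqslant n\},$$ with the convention $\max\emptyset=0$.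
   Formalization: Part (iii) is stated for all n ≠ 1: every automorphism of F_2 has norm at least 2, so with the convention max ∅ = 0 one has β_2(1) = 0, and the claimed equality β_2(n) = n fails at n = 1. *)

(* Defs.v *)
From HB Require Import structures.
From mathcomp Require Import all_boot all_order all_algebra.
From mathcomp Require Import boolp classical_sets.

Set Implicit Arguments.
Unset Strict Implicit.
Unset Printing Implicit Defensive.

Local Open Scope classical_set_scope.
Local Open Scope group_scope.

(* [(i, true)] stands for a_i and [(i, false)] for a_i^-1. *)
Definition letter (r : nat) := ('I_r * bool)%type.

Definition flip r (x : letter r) : letter r := (x.1, ~~ x.2).

Definition reduced r (w : seq (letter r)) : bool :=
  sorted (fun x y => y != flip x) w.

Record free_group (r : nat) := FreeGroup {
  word :> seq (letter r);
  _ : reduced word }.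

HB.instance Definition _ r := [isSub for @word r].
HB.instance Definition _ r := [Countable of free_group r by <:].

Section FreeGroup.
Variable r : nat.
Implicit Types (x y : letter r) (u v w : seq (letter r)) (g h k : free_group r).

(* The reduced form of the product of a letter and a reduced word. *)
Definition push x w : seq (letter r) :=
  if w is y :: w' then if y == flip x then w' else x :: w else [:: x].

Definition word_mul u v : seq (letter r) := foldr push v u.
Definition word_inv u : seq (letter r) := rev (map (@flip r) u).

Lemma flipK : involutive (@flip r).
Proof. by case=> i b; rewrite /flip /= negbK. Qed.

Lemma reduced_behead x w : reduced (x :: w) -> reduced w.
Proof. exact: path_sorted. Qed.

Lemma reduced_push x w : reduced w -> reduced (push x w).
Proof.
case: w => [|y w] //= rw; case: ifP => [_|nyx]; first exact: reduced_behead rw.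
by rewrite /reduced /= nyx.
Qed.

Lemma reduced_word_mul u v : reduced v -> reduced (word_mul u v).
Proof. by move=> rv; elim: u => //= x u IHu; apply: reduced_push. Qed.

Lemma push_reduced x w : reduced (x :: w) -> push x w = x :: w.
Proof. by case: w => [|y w] //= /andP[/negPf->]. Qed.

Lemma pushK x w : reduced w -> push (flip x) (push x w) = w.
Proof.
case: w => [|y w] /=; first by rewrite flipK eqxx.
case: eqP => [-> |_] rw; first by rewrite push_reduced.
by rewrite /= flipK eqxx.
Qed.

Lemma word_mul_push x u w :
  reduced w -> word_mul (push x u) w = push x (word_mul u w).
Proof.
move=> rw; case: u => [|y u] //=; case: eqP => // ->.
by have := pushK (flip x) (reduced_word_mul u rw); rewrite flipK => ->.
Qed.

Lemma word_mulA u v w :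
  reduced w -> word_mul u (word_mul v w) = word_mul (word_mul u v) w.
Proof. by move=> rw; elim: u => //= x u ->; rewrite word_mul_push. Qed.

Lemma word_mulw0 u : reduced u -> word_mul u [::] = u.
Proof.
elim: u => //= x u IHu ru; rewrite IHu ?push_reduced //.
exact: reduced_behead ru.
Qed.

Lemma word_mul_cat u v w : word_mul (u ++ v) w = word_mul u (word_mul v w).
Proof. by rewrite /word_mul foldr_cat. Qed.

Lemma word_mulVw u : reduced u -> word_mul (word_inv u) u = [::].
Proof.
elim: u => //= x u IHu ru.
rewrite /word_inv map_cons rev_cons -cats1 word_mul_cat /=.
by rewrite flipK eqxx IHu //; apply: reduced_behead ru.
Qed.

Lemma word_invK : involutive word_inv.
Proof.
by move=> u; rewrite /word_inv map_rev revK -map_comp map_id_in // => x _ /=;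
  rewrite flipK.
Qed.

Lemma reduced_word_inv u : reduced u -> reduced (word_inv u).
Proof.
rewrite /word_inv /reduced rev_sorted sorted_map.
apply: sub_sorted => x y /=; apply: contraNN => /eqP.
by move=> /(can_inj flipK) ->; rewrite flipK.
Qed.

Lemma free_group_reduced g : reduced g. Proof. by case: g. Qed.

Definition fg_one : free_group r := @FreeGroup r [::] isT.
Definition fg_mul g h : free_group r :=
  FreeGroup (reduced_word_mul g (free_group_reduced h)).
Definition fg_inv g : free_group r :=
  FreeGroup (reduced_word_inv (free_group_reduced g)).

Lemma fg_mulA : associative fg_mul.
Proof. by move=> g h k; apply: val_inj; rewrite /= word_mulA ?free_group_reduced. Qed.
Lemma fg_mul1g : left_id fg_one fg_mul.
Proof. by move=> g; apply: val_inj. Qed.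
Lemma fg_mulg1 : right_id fg_one fg_mul.
Proof. by move=> g; apply: val_inj; rewrite /= word_mulw0 ?free_group_reduced. Qed.
Lemma fg_mulVg : left_inverse fg_one fg_inv fg_mul.
Proof. by move=> g; apply: val_inj; rewrite /= word_mulVw ?free_group_reduced. Qed.
Lemma fg_mulgV : right_inverse fg_one fg_inv fg_mul.
Proof.
move=> g; apply: val_inj; rewrite /= -{1}[word g]word_invK.
by rewrite word_mulVw // reduced_word_inv // free_group_reduced.
Qed.

End FreeGroup.

HB.instance Definition _ r := isGroup.Build (free_group r)
  (@fg_mulA r) (@fg_mul1g r) (@fg_mulg1 r) (@fg_mulVg r) (@fg_mulgV r).

Definition gen r (i : 'I_r) : free_group r := @FreeGroup r [:: (i, true)] isT.

Definition wlen r (g : free_group r) : nat := size (word g).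

Lemma free_group_ind r (P : free_group r -> Prop) :
  P 1 -> (forall i g, P g -> P (gen i * g)) ->
  (forall i g, P g -> P ((gen i)^-1 * g)) -> forall g, P g.
Proof.
move=> P1 Pgen PgenV [w rw]; elim: w rw => [|[i b] w IHw] rw.
  by rewrite (_ : FreeGroup rw = 1) //; apply: val_inj.
have rw' := reduced_behead rw; have Pw := IHw rw'; case: b rw => rw.
  rewrite (_ : FreeGroup rw = gen i * FreeGroup rw') //.
    exact: Pgen.
  by apply: val_inj; rewrite /= -[RHS]/(push _ _) push_reduced.
rewrite (_ : FreeGroup rw = (gen i)^-1 * FreeGroup rw').
  exact: PgenV.
by apply: val_inj; rewrite /= -[RHS]/(push _ _) push_reduced.
Qed.

Record aut (r : nat) := Aut {
  aut_fun :> {multiplicative free_group r -> free_group r};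
  aut_bij : bijective aut_fun }.

HB.instance Definition _ r := gen_eqMixin (aut r).
HB.instance Definition _ r := gen_choiceMixin (aut r).

Section Automorphisms.
Variable r : nat.
Implicit Types (phi psi : aut r) (g x y : free_group r).

Lemma aut_ext phi psi : phi =1 psi -> phi = psi.
Proof.
case: phi psi => [[f mf] bf] [[f' mf'] bf'] /= ff'.
have {}ff' : f = f' by apply: funext.
subst f'; case: mf mf' bf bf' => [[mf]] [[mf']] bf bf'.
have emf := Prop_irrelevance mf mf'; subst mf'.
by congr Aut; apply: Prop_irrelevance.
Qed.

Definition mk_mult (f : free_group r -> free_group r)
    (fM : {morph f : x y / x * y}) : {multiplicative free_group r -> free_group r} :=
  HB.pack f (isMultiplicative.Build _ _ f fM).

Lemma aut_inv_ex phi :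
  exists f : free_group r -> free_group r, cancel phi f /\ cancel f phi.
Proof. by case: (aut_bij phi) => f fK Kf; exists f. Qed.

Definition aut_inv_fun phi := projT1 (cid (aut_inv_ex phi)).

Lemma aut_invK phi : cancel phi (aut_inv_fun phi).
Proof. by rewrite /aut_inv_fun; case: cid => f []. Qed.
Lemma aut_Kinv phi : cancel (aut_inv_fun phi) phi.
Proof. by rewrite /aut_inv_fun; case: cid => f []. Qed.

Lemma aut_inv_funM phi : {morph aut_inv_fun phi : x y / x * y}.
Proof.
by move=> x y; apply: (bij_inj (aut_bij phi)); rewrite gmulfM !aut_Kinv.
Qed.

Lemma aut_one_bij : bijective (mk_mult (fun x y => erefl (x * y))).
Proof. by exists id. Qed.

Lemma aut_mulM phi psi : {morph (psi \o phi) : x y / x * y}.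
Proof. by move=> x y; rewrite /= !gmulfM. Qed.

Lemma aut_mul_bij phi psi : bijective (mk_mult (aut_mulM phi psi)).
Proof. exact: bij_comp (aut_bij psi) (aut_bij phi). Qed.

Lemma aut_inv_bij phi : bijective (mk_mult (@aut_inv_funM phi)).
Proof. by exists phi; [exact: aut_Kinv | exact: aut_invK]. Qed.

Definition aut_one : aut r := Aut aut_one_bij.
(* Automorphisms act on the right: x (phi psi) = (x phi) psi. *)
Definition aut_mul phi psi : aut r := Aut (aut_mul_bij phi psi).
Definition aut_inv phi : aut r := Aut (aut_inv_bij phi).

Lemma aut_mulA : associative aut_mul.
Proof. by move=> *; apply: aut_ext. Qed.
Lemma aut_mul1g : left_id aut_one aut_mul.
Proof. by move=> *; apply: aut_ext. Qed.
Lemma aut_mulg1 : right_id aut_one aut_mul.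
Proof. by move=> *; apply: aut_ext. Qed.
Lemma aut_mulVg : left_inverse aut_one aut_inv aut_mul.
Proof. by move=> phi; apply: aut_ext => x; apply: aut_Kinv. Qed.
Lemma aut_mulgV : right_inverse aut_one aut_inv aut_mul.
Proof. by move=> phi; apply: aut_ext => x; apply: aut_invK. Qed.

End Automorphisms.

HB.instance Definition _ r := isGroup.Build (aut r)
  (@aut_mulA r) (@aut_mul1g r) (@aut_mulg1 r) (@aut_mulVg r) (@aut_mulgV r).

Section Outer.
Variable r : nat.
Implicit Types (phi psi lambda : aut r) (g x y : free_group r).

Lemma autM phi psi x : (phi * psi) x = psi (phi x). Proof. by []. Qed.
Lemma aut1 x : (1 : aut r) x = x. Proof. by []. Qed.

Lemma inner_funM g : {morph (fun x => x ^ g) : x y / x * y}.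
Proof. by move=> x y; rewrite conjMg. Qed.

Lemma inner_bij g : bijective (mk_mult (inner_funM g)).
Proof. by exists (fun x => x ^ g^-1) => x /=; rewrite ?conjgK ?conjgKV. Qed.

(* [x ^ g] is [g^-1 * x * g]. *)
Definition inner g : aut r := Aut (inner_bij g).

Lemma innerE g x : inner g x = x ^ g. Proof. by []. Qed.

Definition Inn : set (aut r) := range inner.

Definition inn_coset phi : set (aut r) := [set phi * lambda | lambda in Inn].

Lemma inner1 : inner 1 = 1.
Proof. by apply: aut_ext => x; rewrite innerE conjg1. Qed.
Lemma innerM g h : inner (g * h) = inner g * inner h.
Proof. by apply: aut_ext => x; rewrite autM !innerE conjgM. Qed.
Lemma inner_aut g phi : inner g * phi = phi * inner (phi g).
Proof.
apply: aut_ext => x; rewrite !autM !innerE.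
suff V : phi g^-1 = (phi g)^-1 by rewrite /conjg !gmulfM V.
have phi1 : phi 1 = 1.
  by apply: (mulgI (phi 1)); rewrite -gmulfM !mulg1.
by apply: (mulgI (phi g)); rewrite -gmulfM !mulgV.
Qed.

Lemma inn_cosetP phi psi : inn_coset phi psi <-> exists g, psi = phi * inner g.
Proof.
split=> [[_ [g _ <-] <-]|[g ->]]; first by exists g.
by exists (inner g) => //; exists g.
Qed.

Lemma inn_coset_refl phi : inn_coset phi phi.
Proof. by apply/inn_cosetP; exists 1; rewrite inner1 mulg1. Qed.

Lemma inn_coset_eq phi psi : inn_coset phi psi -> inn_coset psi = inn_coset phi.
Proof.
move=> /inn_cosetP[g ->]; apply/seteqP; split=> theta /inn_cosetP[h ->]; apply/inn_cosetP.
  by exists (g * h); rewrite innerM mulgA.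
by exists (g^-1 * h); rewrite -mulgA -innerM mulVKg.
Qed.

End Outer.

Record out (r : nat) := Out {
  out_set :> set (aut r);
  out_coset : exists phi, out_set = inn_coset phi }.

HB.instance Definition _ r := gen_eqMixin (out r).
HB.instance Definition _ r := gen_choiceMixin (out r).

Section OutGroup.
Variable r : nat.
Implicit Types (phi psi : aut r) (Phi Psi : out r).

Definition out_class phi : out r := Out (ex_intro _ phi (erefl (inn_coset phi))).

Lemma out_ext Phi Psi : Phi = Psi :> set (aut r) -> Phi = Psi.
Proof.
case: Phi Psi => [A pA] [B pB] /= AB; subst B.
by congr Out; apply: Prop_irrelevance.
Qed.

Lemma out_classP Phi : exists phi, Phi = out_class phi.
Proof. by case: (out_coset Phi) => phi e; exists phi; apply: out_ext. Qed.

Lemma inn_cosetM phi psi :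
  [set a * b | a in inn_coset phi & b in inn_coset psi] = inn_coset (phi * psi).
Proof.
apply/seteqP; split=> [_ [_ /inn_cosetP[g ->] [_ /inn_cosetP[h ->] <-]]|_ /inn_cosetP[g ->]].
  apply/inn_cosetP; exists (psi g * h).
  by rewrite innerM !mulgA -[phi * _ * psi]mulgA inner_aut !mulgA.
exists phi; first exact: inn_coset_refl.
by exists (psi * inner g); [apply/inn_cosetP; exists g | rewrite mulgA].
Qed.

Lemma inn_cosetV phi : [set a^-1 | a in inn_coset phi] = inn_coset phi^-1.
Proof.
have innerV g : (inner g)^-1 = inner g^-1 :> aut r.
  by apply: (mulgI (inner g)); rewrite mulgV -innerM mulgV inner1.
apply/seteqP; split=> [_ [_ /inn_cosetP[g ->] <-]|_ /inn_cosetP[g ->]].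
  by apply/inn_cosetP; eexists; rewrite invgM innerV inner_aut.
exists (phi * inner (phi g)^-1); first by apply/inn_cosetP; exists (phi g)^-1.
by rewrite invgM innerV invgK inner_aut -autM mulgV.
Qed.

Lemma out_one_subproof : exists phi, @Inn r = inn_coset phi.
Proof.
exists 1; apply/seteqP; split=> [_ [g _ <-]|_ /inn_cosetP[g ->]].
  by apply/inn_cosetP; exists g; rewrite mul1g.
by rewrite mul1g; exists g.
Qed.

Lemma out_mul_subproof Phi Psi :
  exists phi, [set a * b | a in Phi & b in Psi] = inn_coset phi.
Proof.
case: (out_classP Phi) (out_classP Psi) => phi -> [psi ->].
by exists (phi * psi); apply: inn_cosetM.
Qed.

Lemma out_inv_subproof Phi : exists phi, [set a^-1 | a in Phi] = inn_coset phi.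
Proof. by case: (out_classP Phi) => phi ->; exists phi^-1; apply: inn_cosetV. Qed.

Definition out_one : out r := Out out_one_subproof.
Definition out_mul Phi Psi : out r := Out (out_mul_subproof Phi Psi).
Definition out_inv Phi : out r := Out (out_inv_subproof Phi).

Lemma out_oneE : out_one = out_class 1.
Proof.
apply: out_ext; apply/seteqP; split=> [_ [g _ <-]|_ /inn_cosetP[g ->]].
  by apply/inn_cosetP; exists g; rewrite mul1g.
by rewrite mul1g; exists g.
Qed.
Lemma out_mulE phi psi : out_mul (out_class phi) (out_class psi) = out_class (phi * psi).
Proof. by apply: out_ext; apply: inn_cosetM. Qed.
Lemma out_invE phi : out_inv (out_class phi) = out_class phi^-1.
Proof. by apply: out_ext; apply: inn_cosetV. Qed.

Lemma out_mulA : associative out_mul.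
Proof.
move=> A B C; case: (out_classP A) (out_classP B) (out_classP C) => a -> [b ->] [c ->].
by rewrite !out_mulE mulgA.
Qed.
Lemma out_mul1g : left_id out_one out_mul.
Proof. by move=> A; case: (out_classP A) => a ->; rewrite out_oneE out_mulE mul1g. Qed.
Lemma out_mulg1 : right_id out_one out_mul.
Proof. by move=> A; case: (out_classP A) => a ->; rewrite out_oneE out_mulE mulg1. Qed.
Lemma out_mulVg : left_inverse out_one out_inv out_mul.
Proof.
by move=> A; case: (out_classP A) => a ->; rewrite out_invE out_oneE out_mulE mulVg.
Qed.
Lemma out_mulgV : right_inverse out_one out_inv out_mul.
Proof.
by move=> A; case: (out_classP A) => a ->; rewrite out_invE out_oneE out_mulE mulgV.
Qed.

End OutGroup.

HB.instance Definition _ r := isGroup.Build (out r)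
  (@out_mulA r) (@out_mul1g r) (@out_mulg1 r) (@out_mulVg r) (@out_mulgV r).

Definition set_min (A : set nat) : nat :=
  xget 0%N [set m | A m /\ forall k, A k -> (m <= k)%N].

(* The value is 0 when [A] has no greatest element, in particular when [A] is
   empty; [alphaP] and [betaP] show that the sets used in [alpha] and [beta]
   have one as soon as they are nonempty. *)
Definition set_max (A : set nat) : nat :=
  xget 0%N [set m | A m /\ forall k, A k -> (k <= m)%N].

Lemma set_minP (A : set nat) : A !=set0 ->
  A (set_min A) /\ forall k, A k -> (set_min A <= k)%N.
Proof.
case=> n An; rewrite /set_min.
apply: (@xgetPex _ 0%N [set m | A m /\ forall k, A k -> (m <= k)%N]).
have ex : exists m, `[< A m >] by exists n; apply/asboolP.
exists (ex_minn ex); case: ex_minnP => m /asboolP Am mmin; split=> // k Ak.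
by apply: mmin; apply/asboolP.
Qed.

Lemma set_maxP (A : set nat) : A !=set0 -> (exists b, forall k, A k -> (k <= b)%N) ->
  A (set_max A) /\ forall k, A k -> (k <= set_max A)%N.
Proof.
case=> n An [b bA]; rewrite /set_max.
apply: (@xgetPex _ 0%N [set m | A m /\ forall k, A k -> (k <= m)%N]).
have ex : exists m, `[< A m >] by exists n; apply/asboolP.
have bd m : `[< A m >] -> (m <= b)%N by move/asboolP; apply: bA.
exists (ex_maxn ex bd); case: ex_maxnP => m /asboolP Am mmax; split=> // k Ak.
by apply: mmax; apply/asboolP.
Qed.

Lemma set_max0 : set_max set0 = 0%N.
Proof. by apply: xgetPN => m []. Qed.

Definition aut_norm r (phi : aut r) : nat := (\sum_(i < r) wlen (phi (gen i)))%N.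

Definition out_norm r (Phi : out r) : nat := set_min [set aut_norm phi | phi in Phi].

Definition alpha (r n : nat) : nat :=
  set_max [set aut_norm phi^-1 | phi in [set phi : aut r | (aut_norm phi <= n)%N]].

Definition beta (r n : nat) : nat :=
  set_max [set out_norm Phi^-1 | Phi in [set Phi : out r | (out_norm Phi <= n)%N]].

Section Gap.
Variable r : nat.
Implicit Types (phi psi : aut r) (Phi : out r).

Lemma multV (f : {multiplicative free_group r -> free_group r}) x :
  f x^-1 = (f x)^-1.
Proof.
have f1 : f 1 = 1 by apply: (mulgI (f 1)); rewrite -gmulfM !mulg1.
by apply: (mulgI (f x)); rewrite -gmulfM !mulgV.
Qed.

Lemma aut_gen_ext phi psi : (forall i, phi (gen i) = psi (gen i)) -> phi = psi.
Proof.
move=> e; apply: aut_ext; elim/free_group_ind => [|i g IH|i g IH].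
- have a1 (f : aut r) : f 1 = 1.
    by apply: (mulgI (f 1)); rewrite -gmulfM !mulg1.
  by rewrite !a1.
- by rewrite !gmulfM e IH.
- by rewrite !gmulfM !multV e IH.
Qed.

Lemma norm_inv_bounded n : exists b, forall phi,
  (aut_norm phi <= n)%N -> (aut_norm phi^-1 <= b)%N.
Proof.
pose code phi : {ffun 'I_r -> n.-bseq (letter r)} :=
  [ffun i => insub_bseq n (word (phi (gen i)))].
pose v c := xget 0%N [set aut_norm phi^-1 | phi in
  [set phi | (aut_norm phi <= n)%N /\ code phi = c]].
exists (\max_c v c) => phi phin.
have -> : aut_norm phi^-1 = v (code phi).
  apply/esym; apply: xget_unique => [|_ [psi [psin e] <-]]; first by exists phi.
  congr (aut_norm _^-1); apply: aut_gen_ext => i.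
  have le theta : (aut_norm theta <= n)%N -> (size (word (theta (gen i))) <= n)%N.
    by apply: leq_trans; rewrite /aut_norm (bigD1 i) //= leq_addr.
  apply: val_inj; move/ffunP/(_ i)/(congr1 val): e.
  by rewrite !ffunE /insub_bseq /= !val_insubd !le.
exact: leq_bigmax.
Qed.

Lemma alphaP n phi : (aut_norm phi <= n)%N ->
  (exists2 psi : aut r, (aut_norm psi <= n)%N & aut_norm psi^-1 = alpha r n)
  /\ (aut_norm phi^-1 <= alpha r n)%N.
Proof.
move=> phin; have [||A B] := @set_maxP
  [set aut_norm phi^-1 | phi in [set phi : aut r | (aut_norm phi <= n)%N]].
- by exists (aut_norm phi^-1), phi.
- by have [b bP] := norm_inv_bounded n; exists b => _ [psi psin <-]; apply: bP.
by split; [case: A => psi ? ?; exists psi | apply: B; exists phi].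
Qed.

Lemma out_normP Phi :
  (exists2 phi, out_set Phi phi & aut_norm phi = out_norm Phi)
  /\ forall phi, out_set Phi phi -> (out_norm Phi <= aut_norm phi)%N.
Proof.
have [|A B] := @set_minP [set aut_norm phi | phi in Phi].
  have [phi ->] := out_classP Phi; exists (aut_norm phi), phi => //.
  exact: inn_coset_refl.
by split; [case: A => phi ? ?; exists phi | move=> phi Pp; apply: B; exists phi].
Qed.

Lemma betaP n Phi : (out_norm Phi <= n)%N ->
  (exists2 Psi : out r, (out_norm Psi <= n)%N & out_norm Psi^-1 = beta r n)
  /\ (out_norm Phi^-1 <= beta r n)%N.
Proof.
move=> Phin; have [||A B] := @set_maxP
  [set out_norm Phi^-1 | Phi in [set Phi : out r | (out_norm Phi <= n)%N]].
- by exists (out_norm Phi^-1), Phi.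
- have [b bP] := norm_inv_bounded n; exists b => _ [Psi Psin <-].
  have [[psi Ppsi psiE] _] := out_normP Psi.
  apply: (@leq_trans (aut_norm psi^-1)); last by apply: bP; rewrite psiE.
  by apply: (out_normP Psi^-1).2; exists psi.
by split; [case: A => Psi ? ?; exists Psi | apply: B; exists Phi].
Qed.

Lemma leq_rank_norm phi : (r <= aut_norm phi)%N.
Proof.
have /(leq_trans _) : (\sum_(i < r) 1 <= aut_norm phi)%N; last first.
  by apply; rewrite sum1_card card_ord.
apply: leq_sum => i _; rewrite lt0n; apply/eqP => /size0nil w0.
have phi1 : phi 1 = 1 by apply: (mulgI (phi 1)); rewrite -gmulfM !mulg1.
have : phi (gen i) = phi 1 by rewrite phi1; apply: val_inj.
by move/(bij_inj (aut_bij phi))/(congr1 (@word r)).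
Qed.

End Gap.

(* No automorphism of F_2 has norm at most 1, so the convention that the maximum
   of the empty set is 0 gives beta_2(1) = 0. *)
Lemma beta2_1 : beta 2 1 = 0%N.
Proof.
rewrite /beta (_ : [set Phi : out 2 | (out_norm Phi <= 1)%N] = set0).
  by rewrite image_set0 set_max0.
apply/seteqP; split=> // Phi /= Phi1.
have [[phi _ phiE] _] := out_normP Phi.
by have := leq_rank_norm phi; rewrite phiE leqNgt ltnS Phi1.
Qed.

(* Main.v *)
Require Import Defs.
From mathcomp Require Import all_boot all_order all_algebra.
From mathcomp Require Import classical_sets.
From mathcomp Require Import zify ring lra.

(** Call a positive automorphism of [F_2] a product of the maps [a -> ab],
[a -> ba] and of the same maps with the generators exchanged; call it standard
after composing it on both sides with permutations of the letters and their
inverses. Three facts about standard automorphisms carry everything.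

Every automorphism is a standard one followed by an inner one
([all_outer_standard]). This is Nielsen reduction, run with conjugations as
additional moves: if no transvection followed by a conjugation shortens the
basis [u, v], then at most half of a basis element cancels on either side of it.
Both halves cancel only when [u = pq] and [v = pmq] up to inversion, and then
conjugating by [p] and dividing by [u] would shorten the basis. So a letter of
each factor survives in every reduced product, and since the products include
all words of length one, [u] and [v] are letters. This gives the decomposition
once the class is known to be stable under left multiplication by transvections
([outer_standard_transvl]).

A standard automorphism and its inverse have the same norm
([aut_normV_standard]). Nothing cancels in a positive automorphism, so its norm
is the sum of the entries of its matrix on the abelianization. Changing the sign
of one generator makes the inverse positive again, and inverting a matrix of
determinant [1] or [-1] only moves its four entries and changes signs.

In [psi * inner g], with [psi] standard, the letters of [g] are processed one by
one. While the next letter touches both images it cyclically permutes them and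
the result is still standard ([standard_rotate]). From the first letter that
leaves one image untouched, that image grows by two with each letter, while the
other one, which was cyclically reduced, never becomes shorter. Hence every
automorphism is [phi = psi * inner g] with
[aut_norm psi + 2 * wlen g <= aut_norm phi] ([standard_decomposition]).

For [beta], take [phi] of least norm in its class: the inverse class contains
[psi^-1], whose norm is that of [psi], hence at most that of [phi]. Equality is
reached by [b -> b a^m], whose inverse has exponent sums that forbid anything
shorter. For the upper bound on [alpha], let [k] be the norm of [psi]. Up to
conjugation by [psi^-1 g], a word of length at most [(k - 1) |g|], the inverse of
[phi] is [psi^-1]; its norm is therefore at most [4 (k - 1) |g|]
([aut_normV_inner_bound]), while [(k - 1) + 2 |g| <= n - 1], and the bound is the
inequality between arithmetic and geometric means. For the lower bound on
[alpha], take [b -> b a^-m] followed by conjugation by [b^-l a^-1]. Its norm is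
at most [m + 4 l + 6], and its inverse sends both generators to conjugates by
[(b a^m)^l] without cancellation, so that its norm is about [4 l m], which is
[n^2 / 4] when [m] and [4 l] are both close to [n / 2]. *)

Set Implicit Arguments.
Unset Strict Implicit.
Unset Printing Implicit Defensive.

Arguments wlen {r} g%_g.
Arguments word {r} _%_g.
Arguments aut_norm {r} phi%_g.

(** * Common prefixes *)

Section Lcp.
Variable T : eqType.
Implicit Types s t : seq T.

Fixpoint lcp s t : nat :=
  match s, t with
  | x :: s', y :: t' => if x == y then (lcp s' t').+1 else 0
  | _, _ => 0
  end.

Lemma lcpC s t : lcp s t = lcp t s.
Proof. by elim: s t => [|x s IHs] [|y t] //=; rewrite eq_sym IHs. Qed.

Lemma leq_lcp s t : lcp s t <= size s.
Proof. by elim: s t => [|x s IHs] [|y t] //=; case: (x == y) => //; apply: IHs. Qed.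

Lemma take_lcp s t : take (lcp s t) s = take (lcp s t) t.
Proof.
by elim: s t => [|x s IHs] [|y t] //=; case: eqP => //= ->; rewrite IHs.
Qed.

Lemma lcp_geP k s t :
  k <= size s -> k <= size t -> take k s = take k t -> k <= lcp s t.
Proof.
elim: k s t => // k IHk [|x s] [|y t] //= ks kt [-> est].
by rewrite eqxx ltnS; apply: IHk.
Qed.

Lemma lcp_take m s t v : lcp s t < m -> m <= size t ->
  lcp s (take m t ++ v) = lcp s t.
Proof.
elim: m s t => // m IHm [|x s] [|y t] //=; case: eqP => //= _ lm mt.
by rewrite IHm.
Qed.

Lemma lcp_eq0 s t : ohead s != ohead t -> lcp s t = 0.
Proof. by case: s t => [|x s] [|y t] //=; case: (x =P y) => // ->; rewrite eqxx. Qed.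

End Lcp.

(** * Words and cancellation *)

Section Words.
Local Open Scope group_scope.
Variable r : nat.
Implicit Types (x y z c : letter r) (g h k : free_group r) (u v : seq (letter r)).

Definition lett x : free_group r := @FreeGroup r [:: x] isT.

Lemma lettV x : lett (flip x) = (lett x)^-1.
Proof. exact: val_inj. Qed.

Lemma flip_neq x : flip x != x.
Proof. by case: x => i b; rewrite /flip xpair_eqE /= eqxx; case: b. Qed.

Lemma lett_inj : injective lett.
Proof. by move=> x y [->]. Qed.

Lemma lett_cases x y : x.1 = y.1 -> x = y \/ x = flip y.
Proof.
by case: x y => [i b] [j d] /= ->; case: b d => [] []; [left | right | right | left].
Qed.

Lemma word_mul_cat_reduced u v : reduced (u ++ v) -> word_mul u v = u ++ v.
Proof.
elim: u => //= x u IHu ruv; rewrite IHu ?push_reduced //.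
exact: reduced_behead ruv.
Qed.

Lemma wlen_eq0 g : wlen g = 0%N -> g = 1.
Proof. by move/size0nil => w0; apply: val_inj. Qed.

Lemma wlen_eq1 g : wlen g = 1%N -> exists x, g = lett x.
Proof.
rewrite /wlen; case: g => [[|x [|y w]] rw] //= _.
by exists x; apply: val_inj.
Qed.

Lemma wlenV g : wlen g^-1 = wlen g.
Proof. by rewrite /wlen /= /word_inv size_rev size_map. Qed.

Lemma size_push x v : (size (push x v) <= (size v).+1)%N.
Proof. by case: v => //= y v; case: ifP => //= _; lia. Qed.

Lemma leq_wlenM g h : (wlen (g * h) <= wlen g + wlen h)%N.
Proof.
rewrite /wlen /=; elim: (word g) => //= x u IHu.
by apply: leq_trans (size_push _ _) _; rewrite addSn ltnS.
Qed.

Lemma word_lettM x g : reduced (x :: word g) -> word (lett x * g) = x :: word g.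
Proof. exact: push_reduced. Qed.

Lemma word_ind (P : free_group r -> Prop) : P 1 ->
  (forall x g, reduced (x :: word g) -> P g -> P (lett x * g)) -> forall g, P g.
Proof.
move=> P1 PM [w]; elim: w => [|x w IHw] rw.
  by rewrite (_ : FreeGroup rw = 1) //; apply: val_inj.
have rw' := reduced_behead rw.
rewrite (_ : FreeGroup rw = lett x * FreeGroup rw'); first exact: PM (IHw _).
by apply: val_inj; rewrite /= -[RHS]/(push _ _) push_reduced.
Qed.

(** The common prefix of [g] and [h] is exactly what cancels, because the first
letters where they differ block any further cancellation. All length
computations below rest on this. *)
Lemma word_mulV g h (k := lcp (word g) (word h)) :
  word (g^-1 * h) = word_inv (drop k (word g)) ++ drop k (word h).
Proof.
rewrite {}/k; case: g h => [s rs] [t rt] /=; rewrite -[LHS]/(word_mul (word_inv s) t).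
elim: s rs t rt => [|x s IHs] rs t rt; first by rewrite /= drop0.
have rs' := reduced_behead rs.
have red0 : reduced (word_inv (x :: s)) by apply: reduced_word_inv.
have step : word_inv (x :: s) = word_inv s ++ [:: flip x].
  by rewrite /word_inv /= rev_cons cats1.
case: t rt => [|y t] rt.
  rewrite /= cats0 step word_mul_cat /= word_mul_cat_reduced //.
  by rewrite -step.
rewrite /=; case: eqP => [exy|nxy].
  rewrite step word_mul_cat /= flipK exy eqxx /=.
  exact: IHs rs' t (reduced_behead rt).
rewrite word_mul_cat_reduced // step -catA /=.
move: red0; rewrite step cats1 /reduced sorted_cat_cons => -> /=.
by rewrite flipK eq_sym (introF eqP nxy).
Qed.

Lemma wlen_mulV g h :
  wlen (g^-1 * h) = (wlen g - lcp (word g) (word h) + (wlen h - lcp (word g) (word h)))%N.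
Proof. by rewrite /wlen word_mulV size_cat /word_inv size_rev size_map !size_drop. Qed.

Lemma word_mul_disjoint g h : ohead (word g^-1) != ohead (word h) ->
  word (g * h) = word g ++ word h.
Proof.
move=> gh; rewrite -{1}[g]invgK word_mulV lcp_eq0 // !drop0.
by rewrite -[word_inv _]/(word g^-1^-1) invgK.
Qed.

(** If a reduced word and its inverse agreed up to the middle, the middle letter
would be its own inverse, or the two middle letters would cancel. *)
Lemma lcpV_lt g : g != 1 -> (2 * lcp (word g) (word g^-1) < wlen g)%N.
Proof.
move=> g1; rewrite ltnNge; apply/negP => le; set k := lcp _ _ in le.
have L0 : (0 < wlen g)%N.
  by rewrite lt0n; apply: contraNneq g1 => /wlen_eq0 ->.
have [x0 _] : exists x0 : letter r, true.
  by move: L0; rewrite /wlen; case: (word g) => // x0 _; exists x0.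
have nthV i : (i < k)%N ->
    nth x0 (word g) i = flip (nth x0 (word g) (wlen g - i.+1)).
  move=> ik; have kg : (k <= wlen g)%N := leq_lcp _ _.
  rewrite -(nth_take _ ik) take_lcp nth_take // /= /word_inv.
  rewrite nth_rev size_map -/(wlen g); last lia.
  by rewrite (nth_map x0) //; rewrite /wlen in kg ik *; lia.
pose m := ((wlen g).-1)./2.
have := nthV m; rewrite /m.
have [odL|evL] := boolP (odd (wlen g)).
  rewrite (_ : wlen g - _ = m)%N /m; last lia.
  by move=> /(_ ltac:(lia)) e; have := flip_neq (nth x0 (word g) m); rewrite /m -e eqxx.
rewrite (_ : wlen g - _ = m.+1)%N /m; last lia.
move=> /(_ ltac:(lia)) e.
have /(sortedP x0) /(_ m) := free_group_reduced g.
rewrite /m [in X in flip X]e flipK eqxx => H.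
by have := H ltac:(rewrite -/(wlen g); lia).
Qed.

End Words.

(** * Automorphisms given on the generators *)

Section Homs.
Local Open Scope group_scope.
Variable r : nat.
Implicit Types (x y z c : letter r) (g h k : free_group r) (u v : seq (letter r)).
Implicit Types (phi psi : aut r).

Lemma aut_1 phi : phi 1 = 1.
Proof. by apply: (mulgI (phi 1)); rewrite -gmulfM !mulg1. Qed.

Lemma aut_invE phi g : phi^-1 (phi g) = g.
Proof. exact: (aut_invK phi g). Qed.

Lemma autK_inv phi g : phi (phi^-1 g) = g.
Proof. exact: (aut_Kinv phi g). Qed.

Lemma autJ phi g h : phi (g ^ h) = phi g ^ phi h.
Proof. by rewrite /conjg !gmulfM multV. Qed.

Lemma autX phi g n : phi (g ^+ n) = phi g ^+ n.
Proof. by elim: n => [|n IHn]; rewrite ?aut_1 // !expgS gmulfM IHn. Qed.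

Lemma lett_gen x : lett x = if x.2 then gen x.1 else (gen x.1)^-1.
Proof. by case: x => i []; apply: val_inj. Qed.

Lemma aut_lett_ext phi psi :
  (forall i, exists2 x, x.1 = i & phi (lett x) = psi (lett x)) -> phi = psi.
Proof.
move=> e; apply: aut_gen_ext => i; have [x <-] := e i.
by rewrite lett_gen; case: x.2 => //; rewrite !multV => /invg_inj.
Qed.

Lemma wlen_aut_lett phi x : wlen (phi (lett x)) = wlen (phi (gen x.1)).
Proof. by rewrite lett_gen; case: x.2; rewrite // multV wlenV. Qed.

Definition extend_word (f : 'I_r -> free_group r) u : free_group r :=
  foldr (fun x g => (if x.2 then f x.1 else (f x.1)^-1) * g) 1 u.

Definition extend f g := extend_word f (word g).

Lemma extend_push f x u :
  extend_word f (push x u) = (if x.2 then f x.1 else (f x.1)^-1) * extend_word f u.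
Proof.
case: u => //= y u; case: eqP => // -> /=.
by case: x => i [] /=; rewrite ?mulVKg ?mulKg.
Qed.

Lemma extendM f : {morph extend f : g h / g * h}.
Proof.
move=> g h; rewrite /extend -[word (g * h)]/(foldr (@push r) (word h) (word g)).
by elim: (word g) => [|x u IHu] /=; rewrite ?mul1g // extend_push IHu mulgA.
Qed.

Lemma extend_gen f i : extend f (gen i) = f i.
Proof. exact: mulg1. Qed.

Lemma extendV f g : extend f g^-1 = (extend f g)^-1.
Proof. exact: multV (mk_mult (extendM f)) g. Qed.

Lemma extend_cancel f f' : (forall i, extend f' (f i) = gen i) ->
  cancel (extend f) (extend f').
Proof.
move=> ff'; elim/free_group_ind => // i g IH.
  by rewrite extendM extend_gen extendM ff' IH.
by rewrite extendM extendV extend_gen extendM extendV ff' IH.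
Qed.

Definition aut_of_extend f f' (ff' : forall i, extend f' (f i) = gen i)
    (f'f : forall i, extend f (f' i) = gen i) : aut r :=
  @Aut r (mk_mult (extendM f)) (Bijective (extend_cancel ff') (extend_cancel f'f)).

(** Indexing transvections by two letters rather than two generators covers
[a -> ab], [a -> ba] and their inverses at once. The test [x.1 != y.1] makes the
map invertible for all letters: it is the identity when the indices agree. *)
Definition transv_gen x y i : free_group r :=
  if (i == x.1) && (x.1 != y.1) then
    if x.2 then lett x * lett y else (lett x * lett y)^-1
  else gen i.

Lemma transv_genK x y i :
  extend (transv_gen x (flip y)) (transv_gen x y i) = gen i.
Proof.
have [xy|nxy] := eqVneq x.1 y.1.
  by rewrite [transv_gen x y i]/transv_gen xy eqxx andbF extend_gen /transv_gen xy eqxx andbF.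
have Fy : extend (transv_gen x (flip y)) (lett y) = lett y.
  by rewrite lett_gen; case: y.2; rewrite ?extendV extend_gen /transv_gen eq_sym
    (negPf nxy).
have Fx : extend (transv_gen x (flip y)) (lett x) = lett x * (lett y)^-1.
  by rewrite [in LHS]lett_gen; case Ex: x.2;
    rewrite ?extendV extend_gen /transv_gen eqxx nxy Ex ?invgK lettV.
rewrite [transv_gen x y i]/transv_gen nxy andbT; case: eqVneq => [->|nix].
  by case Ex: x.2; rewrite ?extendV extendM Fx Fy mulgVK lett_gen Ex ?invgK.
by rewrite extend_gen /transv_gen (negPf nix).
Qed.

Lemma transv_genKV x y i :
  extend (transv_gen x y) (transv_gen x (flip y) i) = gen i.
Proof. by rewrite -{1}[y]flipK transv_genK. Qed.

Definition transv x y : aut r := aut_of_extend (transv_genK x y) (transv_genKV x y).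

Lemma transvV x y : (transv x y)^-1 = transv x (flip y).
Proof.
apply: (mulgI (transv x y)); rewrite mulgV; apply/esym/aut_gen_ext => i.
by rewrite autM -[transv x y _]/(extend _ _) extend_gen; apply: transv_genK.
Qed.

Lemma transv_x x y : x.1 != y.1 -> transv x y (lett x) = lett x * lett y.
Proof.
move=> nxy; rewrite [in LHS]lett_gen; case Ex: x.2;
  by rewrite ?multV -[transv x y _]/(extend _ _) extend_gen /transv_gen eqxx nxy Ex ?invgK.
Qed.

Lemma transv_other x y z : z.1 != x.1 -> transv x y (lett z) = lett z.
Proof.
move=> nzx; rewrite lett_gen; case: z.2;
  by rewrite ?multV -[transv x y _]/(extend _ _) extend_gen /transv_gen (negPf nzx).
Qed.

Definition negate_gen (j i : 'I_r) : free_group r :=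
  if i == j then (gen i)^-1 else gen i.

Lemma negate_genK j i : extend (negate_gen j) (negate_gen j i) = gen i.
Proof.
rewrite [negate_gen j i]/negate_gen; case: ifP => ij;
  by rewrite ?extendV extend_gen /negate_gen ij ?invgK.
Qed.

Definition negate j : aut r := aut_of_extend (negate_genK j) (negate_genK j).

Lemma negate_lett j x : negate j (lett x) = lett (x.1, x.2 (+) (x.1 == j)).
Proof.
have E i : negate j (gen i) = negate_gen j i by apply: extend_gen.
rewrite !lett_gen [(_, _).1]/= [(_, _).2]/=.
by case: x.2; rewrite ?multV E /negate_gen; case: eqP; rewrite ?invgK.
Qed.

Lemma negateK j : negate j * negate j = 1.
Proof.
by apply: aut_gen_ext => i; rewrite autM; apply: (extend_cancel (negate_genK j)).
Qed.

(** These automorphisms permute the letters, since they are injective; a condition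
on lengths makes closure under products and inverses easy. *)
Definition relabels phi := forall x, wlen (phi (lett x)) = 1%N.

Lemma relabelsP phi x : relabels phi -> exists y, phi (lett x) = lett y.
Proof. by move=> /(_ x) /wlen_eq1. Qed.

Lemma relabelsM phi psi : relabels phi -> relabels psi -> relabels (phi * psi).
Proof. by move=> P Q x; have [y e] := relabelsP x P; rewrite autM e Q. Qed.

Lemma relabels_negate j : relabels (negate j).
Proof. by move=> x; rewrite negate_lett. Qed.

(** An injective map of the finite set of letters is onto. *)
Lemma relabelsV phi : relabels phi -> relabels phi^-1.
Proof.
move=> P x; pose f y := projT1 (boolp.cid (relabelsP y P)).
have fE y : phi (lett y) = lett (f y) by rewrite /f; case: boolp.cid.
have finj : injective f.
  move=> y z fyz; apply/lett_inj/(bij_inj (aut_bij phi)).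
  by rewrite !fE fyz.
have [g _ gK] := injF_bij finj.
by rewrite -(gK x) -fE aut_invE.
Qed.

Lemma leq_wlen_aut phi K g : (forall x, wlen (phi (lett x)) <= K)%N ->
  (wlen (phi g) <= K * wlen g)%N.
Proof.
move=> le; elim/word_ind: g => [|x g rxg IH]; first by rewrite aut_1.
rewrite gmulfM [in leqRHS]/wlen word_lettM //= mulnS.
by apply: leq_trans (leq_wlenM _ _) _; apply: leq_add.
Qed.

Lemma relabels_wlen phi g : relabels phi -> wlen (phi g) = wlen g.
Proof.
move=> P; have le psi h : relabels psi -> (wlen (psi h) <= wlen h)%N.
  by move=> Q; have := @leq_wlen_aut psi 1 h; rewrite mul1n; apply=> x; rewrite Q.
by apply/eqP; rewrite eqn_leq le //= -{1}(aut_invE phi g); apply/le/relabelsV.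
Qed.

Lemma aut_norm_relabelr phi psi : relabels psi ->
  aut_norm (phi * psi) = aut_norm phi.
Proof. by move=> P; apply: eq_bigr => i _; rewrite autM relabels_wlen. Qed.

Lemma relabels_index phi x y x' y' : relabels phi ->
  phi (lett x) = lett x' -> phi (lett y) = lett y' -> x.1 != y.1 -> x'.1 != y'.1.
Proof.
move=> P ex ey; apply: contraNneq => /lett_cases[] e.
  by move: ex; rewrite e -ey => /(bij_inj (aut_bij phi)) /lett_inj ->.
by move: ex; rewrite e lettV -ey -multV -lettV => /(bij_inj (aut_bij phi)) /lett_inj ->.
Qed.

End Homs.

(** * Exponent sums and words of one sign *)

Section Heights.
Variable r : nat.
Implicit Types (w : 'I_r -> int) (x y z c : letter r) (g h k : free_group r).
Implicit Types (phi psi : aut r) (u v : seq (letter r)) (s : bool).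
Local Open Scope group_scope.

Definition letter_height w x : int := (if x.2 then w x.1 else - w x.1)%R.

(** The additive extension of integer weights on the generators: weights [0] and
[1] give the exponent sums, and weights bounded by [1] give lower bounds on
length that are invariant under conjugation. *)
Definition height w g : int := (\sum_(x <- word g) letter_height w x)%R.

Lemma letter_heightV w x : letter_height w (flip x) = (- letter_height w x)%R.
Proof. by case: x => i []; rewrite /letter_height //= GRing.opprK. Qed.

Lemma height1 w : height w 1 = 0%R. Proof. exact: big_nil. Qed.

Lemma height_lett w x : height w (lett x) = letter_height w x.
Proof. exact: big_seq1. Qed.

Lemma heightM w g h : height w (g * h) = (height w g + height w h)%R.
Proof.
have push_height x u : (\sum_(y <- push x u) letter_height w y =
    letter_height w x + \sum_(y <- u) letter_height w y)%R.
  case: u => [|y u] /=; first by rewrite !big_seq1 big_nil GRing.addr0.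
  case: eqP => [->|_]; last by rewrite big_cons.
  by rewrite big_cons letter_heightV GRing.addNKr.
rewrite /height -[word (g * h)]/(foldr (@push r) (word h) (word g)).
elim: (word g) => [|x u IHu] /=; first by rewrite big_nil GRing.add0r.
by rewrite push_height IHu big_cons GRing.addrA.
Qed.

Lemma heightV w g : height w g^-1 = (- height w g)%R.
Proof.
by apply: (GRing.addrI (height w g)); rewrite -heightM mulgV height1 GRing.subrr.
Qed.

Lemma heightJ w g h : height w (g ^ h) = height w g.
Proof. by rewrite conjgE !heightM heightV; ring. Qed.

Lemma heightX w g n : height w (g ^+ n) = (height w g *+ n)%R.
Proof.
elim: n => [|n IHn]; first by rewrite height1.
by rewrite expgS heightM IHn GRing.mulrS.
Qed.

Lemma leq_height w g : (forall i, `|w i| <= 1)%N -> (`|height w g| <= wlen g)%N.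
Proof.
move=> w1; rewrite /height /wlen; elim: (word g) => [|x u IHu]; first by rewrite big_nil.
have leqD (a b : int) n : (`|a| <= 1 -> `|b| <= n -> `|(a + b)%R| <= n.+1)%N by lia.
rewrite big_cons /=; apply: leqD IHu.
by rewrite /letter_height; case: x.2; rewrite ?abszN.
Qed.

(** Heights are the homomorphisms to the integers, so automorphisms act on them:
this is the action on the dual of the abelianization. *)
Lemma height_aut w phi g :
  height w (phi g) = height (fun i => height w (phi (gen i))) g.
Proof.
elim/free_group_ind: g => [|i g IH|i g IH]; first by rewrite aut_1 !height1.
  by rewrite gmulfM !heightM IH -[gen i in RHS]/(lett (i, true)) height_lett.
rewrite gmulfM multV !heightM !heightV IH; congr (- _ + _)%R.
by rewrite -[gen i in RHS]/(lett (i, true)) height_lett.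
Qed.

Definition signed s g := all (fun x => x.2 == s) (word g).

Lemma word_signedM s g h : signed s g -> signed s h ->
  word (g * h) = word g ++ word h.
Proof.
move=> sg sh; apply: word_mul_cat_reduced.
have : all (fun x => x.2 == s) (word g ++ word h) by rewrite all_cat; apply/andP.
elim: (_ ++ _) => //= x u IHu /andP[/eqP xs su]; move: (IHu su).
case: u su {IHu} => //= y u /andP[/eqP ys _]; rewrite /reduced /= => ->.
rewrite andbT; apply: contraTneq isT => yx.
by move: ys; rewrite yx /= xs; case: (s).
Qed.

Lemma signedM s g h : signed s g -> signed s h -> signed s (g * h).
Proof. by move=> sg sh; rewrite /signed (word_signedM sg sh) all_cat; apply/andP. Qed.

Lemma signedV s g : signed s g^-1 = signed (~~ s) g.
Proof.
rewrite /signed /= /word_inv all_rev all_map; apply: eq_all => x /=.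
by case: x.2 s => [] [].
Qed.

Lemma signed_lett s x : signed s (lett x) = (x.2 == s).
Proof. exact: andbT. Qed.

Lemma wlen_signed g : signed true g -> Posz (wlen g) = height (fun _ => 1%R) g.
Proof.
rewrite /signed /wlen /height; elim: (word g) => [|x u IHu] /=; first by rewrite big_nil.
by case/andP=> /eqP xs /IHu e; rewrite big_cons -e /letter_height xs intS.
Qed.

Lemma eq_height w w' g : w =1 w' -> height w g = height w' g.
Proof. by move=> e; apply: eq_bigr => x _; rewrite /letter_height e. Qed.

Lemma heightDw w w' g :
  height (fun i => w i + w' i)%R g = (height w g + height w' g)%R.
Proof.
rewrite /height -big_split; apply: eq_bigr => x _ /=.
by rewrite /letter_height; case: x.2; rewrite // GRing.opprD.
Qed.

Lemma signed_word_ind s (P : free_group r -> Prop) : P 1 ->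
  (forall x g, x.2 = s -> signed s g -> word (lett x * g) = x :: word g ->
    P g -> P (lett x * g)) ->
  forall g, signed s g -> P g.
Proof.
move=> P1 PM; elim/word_ind => // x g rxg IH.
rewrite /signed word_lettM //= => /andP[/eqP xs sg].
by apply: PM => //; [exact: word_lettM | exact: IH].
Qed.

End Heights.

(** * The monoid of positive automorphisms *)

Section Positive.
Local Open Scope group_scope.
Implicit Types (x y z c : letter 2) (g h k : free_group 2).
Implicit Types (phi psi theta : aut 2) (s : bool).

Lemma index2 (i j k : 'I_2) : i != j -> k = i \/ k = j.
Proof.
move=> ij; have [-> |ki] := eqVneq k i; first by left.
right; apply: val_inj; move: ij ki (ltn_ord i) (ltn_ord j) (ltn_ord k).
by rewrite -!(inj_eq val_inj) /=; lia.
Qed.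

Lemma aut2_ext phi psi x y : x.1 != y.1 ->
  phi (lett x) = psi (lett x) -> phi (lett y) = psi (lett y) -> phi = psi.
Proof.
move=> nxy ex ey; apply: aut_lett_ext => i.
by case: (index2 i nxy) => ->; [exists x | exists y].
Qed.

Lemma aut_norm2 phi x y : x.1 != y.1 ->
  aut_norm phi = (wlen (phi (lett x)) + wlen (phi (lett y)))%N.
Proof.
move=> nxy; rewrite (wlen_aut_lett phi x) (wlen_aut_lett phi y) /aut_norm (bigD1 x.1) //=; congr (_ + _)%N.
rewrite (big_pred1 y.1) // => i /=.
by case: (index2 i nxy) => ->; rewrite eqxx ?(negPf nxy) // eq_sym nxy.
Qed.

Lemma aut_norm_relabell phi psi : relabels phi ->
  aut_norm (phi * psi) = aut_norm psi.
Proof.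
move=> P; pose x : letter 2 := (ord0, true); pose y : letter 2 := (ord_max, true).
have nxy : x.1 != y.1 by [].
have [x' ex] := relabelsP x P; have [y' ey] := relabelsP y P.
rewrite (aut_norm2 _ nxy) !autM ex ey (@aut_norm2 psi x' y') //.
exact: relabels_index nxy.
Qed.

(** Left and right multiplication by the same generator differ by conjugation by
it. *)
Lemma transv_flip x y : x.1 != y.1 ->
  transv (flip x) (flip y) = transv x y * inner (lett y)^-1.
Proof.
move=> nxy; apply: (aut2_ext nxy); rewrite autM innerE conjgE invgK.
  have /(congr1 (fun g => g^-1)) := @transv_x _ (flip x) (flip y) nxy.
  by rewrite -multV !lettV !invgK transv_x // => ->; rewrite invgM !invgK mulgK.
by rewrite !transv_other 1?eq_sym // mulgV mulg1.
Qed.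

Lemma transv_relabels phi x y x' y' : relabels phi -> x.1 != y.1 ->
  phi (lett x) = lett x' -> phi (lett y) = lett y' ->
  transv x y * phi = phi * transv x' y'.
Proof.
move=> P nxy ex ey; have nxy' := relabels_index P ex ey nxy.
apply: (aut2_ext nxy); rewrite !autM.
  by rewrite transv_x // gmulfM ex ey transv_x.
by rewrite transv_other 1?eq_sym // ey transv_other // eq_sym.
Qed.

(** For [x] and [y] positive, [transv x y] multiplies a generator by another one on
the right. For [x = a^-1] and [y = b^-1] it sends [a] to [ba], a multiplication on
the left. Requiring only equal signs treats the two cases together. *)
Inductive positive : aut 2 -> Prop :=
| positive1 : positive 1
| positiveMr theta x y : x.1 != y.1 -> x.2 = y.2 -> positive theta ->
    positive (theta * transv x y).

Lemma positiveM theta theta' : positive theta -> positive theta' ->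
  positive (theta * theta').
Proof.
move=> pt; elim=> [|t x y nxy sxy _ IH]; first by rewrite mulg1.
by rewrite mulgA; apply: positiveMr.
Qed.

Lemma positive_transv x y : x.1 != y.1 -> x.2 = y.2 -> positive (transv x y).
Proof. by move=> nxy sxy; rewrite -[transv x y]mul1g; apply: positiveMr positive1. Qed.

(** Products can be peeled off from either end. *)
Lemma positive_left_ind (P : aut 2 -> Prop) : P 1 ->
  (forall x y theta, x.1 != y.1 -> x.2 = y.2 -> positive theta -> P theta ->
    P (transv x y * theta)) ->
  forall theta, positive theta -> P theta.
Proof.
move=> P1 PM theta pt; suff H t : positive t -> P t -> P (theta * t).
  by rewrite -[theta]mulg1; apply: H positive1 P1.
elim: pt t => [|t' x y nxy sxy _ IH] t pt Pt; first by rewrite mul1g.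
rewrite -mulgA; apply: IH; last exact: PM.
by apply: positiveM => //; apply: positive_transv.
Qed.

Lemma signed_transv s x y g : x.1 != y.1 -> x.2 = y.2 ->
  signed s g -> signed s (transv x y g).
Proof.
move=> nxy sxy; elim/signed_word_ind => [|z k zs _ _ IH]; first by rewrite aut_1.
rewrite gmulfM; apply: signedM => //.
have [exz|nxz] := eqVneq z.1 x.1; last by rewrite transv_other // signed_lett zs.
have [ezx|ezx] := lett_cases exz.
  by rewrite ezx transv_x //; apply: signedM; rewrite signed_lett -?sxy -zs ezx.
rewrite ezx lettV multV signedV transv_x //.
by apply: signedM; rewrite signed_lett -?sxy -zs ezx /= negbK.
Qed.

Lemma positive_signed theta i : positive theta -> signed true (theta (gen i)).
Proof.
move=> pt; elim: pt i => [|t x y nxy sxy _ IH] i; first by [].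
by rewrite autM; apply: signed_transv.
Qed.
End Positive.

(** * The norm of the inverse *)

Section InverseNorm.
Local Open Scope group_scope.
Implicit Types (x y z c : letter 2) (g h : free_group 2) (i j k : 'I_2).
Implicit Types (phi psi theta : aut 2) (s : bool) (w : 'I_2 -> int).

Lemma height_transv w x y i : x.1 != y.1 -> x.2 = y.2 ->
  height w (transv x y (gen i)) = (w i + (if i == x.1 then w y.1 else 0))%R.
Proof.
move=> nxy sxy; have hgen (k : 'I_2) : height w (gen k) = w k by exact: height_lett w (k, true).
have [->|nix] := eqVneq; last first.
  by rewrite -[gen i]/(lett (i, true)) transv_other // height_lett GRing.addr0.
have := congr1 (height w) (transv_x nxy); rewrite heightM !height_lett /letter_height -sxy.
rewrite lett_gen; case: x.2 => //; rewrite multV heightV => /(congr1 -%R%R).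
by rewrite GRing.opprK => ->; rewrite GRing.opprD !GRing.opprK.
Qed.

(** The matrix of [phi] on the abelianization, one row for each image. *)
Definition expo phi i j : int := height (fun k => Posz (k == j)) (phi (gen i)).

Lemma expo_transv_mull phi x y i j : x.1 != y.1 -> x.2 = y.2 ->
  expo (transv x y * phi) i j =
  (expo phi i j + (if i == x.1 then expo phi y.1 j else 0))%R.
Proof. by move=> nxy sxy; rewrite /expo autM height_aut height_transv. Qed.

Lemma expo_transv_mulr phi x y i j : x.1 != y.1 -> x.2 = y.2 ->
  expo (phi * transv x y) i j =
  (expo phi i j + (if j == y.1 then expo phi i x.1 else 0))%R.
Proof.
move=> nxy sxy; rewrite /expo autM height_aut.
rewrite (eq_height _ (fun k => height_transv _ k nxy sxy)) heightDw; congr (_ + _)%R.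
rewrite (eq_sym j); case: (eqVneq y.1 j) => [_|nyj].
  by apply: eq_height => k; case: (k == x.1).
by rewrite /height big1 // => z _; rewrite /letter_height; case: z.2; case: eqP.
Qed.

Lemma rev_ord2 i j : i != j -> rev_ord i = j.
Proof. by move=> ij; case: (index2 (rev_ord i) ij) => // /(congr1 val) /=; case: i j ij => [[|[]]] // ? [[|[]]]. Qed.

(** Conjugation by the automorphism negating one generator turns inverses of
positive transvections into positive transvections. The matrix of [theta'] is the
inverse of that of [theta] with signs removed: the diagonal entries are exchanged
and the others stay, which is what reversing and swapping the indices does. *)
Lemma positive_inv theta : positive theta ->
  exists theta', [/\ positive theta',
    theta^-1 = negate ord0 * theta' * negate ord0 &
    forall i j, expo theta' i j = expo theta (rev_ord j) (rev_ord i)].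
Proof.
elim=> [|t x y nxy sxy _ [t' [pt' et' xt']]].
  exists 1; split; first exact: positive1.
    by rewrite mulg1 negateK invg1.
  move=> i j; rewrite /expo !aut1 -![gen _]/(lett (_, true)) !height_lett /letter_height /=.
  by rewrite (inj_eq rev_ord_inj) eq_sym.
pose x' : letter 2 := (x.1, x.2 (+) (x.1 == ord0)).
pose y' : letter 2 := (y.1, ~~ y.2 (+) (y.1 == ord0)).
have sxy' : x'.2 = y'.2.
  rewrite /= sxy; have [e|n] := eqVneq x.1 ord0.
    by rewrite eq_sym -e (negPf nxy); case: (y.2).
  by case: (index2 ord0 nxy) => e; rewrite e ?eqxx in n *; case: (y.2).
exists (transv x' y' * t'); split.
- by apply: positiveM => //; apply: positive_transv.
- rewrite invgM transvV et' !mulgA.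
  by rewrite (@transv_relabels _ x (flip y) x' y' (relabels_negate ord0)) //; apply: negate_lett.
move=> i j; rewrite expo_transv_mull // expo_transv_mulr // !xt'.
have -> : (rev_ord i == y.1) = (i == x.1).
  by rewrite -(rev_ord2 nxy) (inj_eq rev_ord_inj).
by rewrite [rev_ord y'.1](@rev_ord2 y.1 x.1) // eq_sym.
Qed.

Lemma aut_norm_positive theta : positive theta ->
  Posz (aut_norm theta) = (\sum_(i < 2) \sum_(j < 2) expo theta i j)%R.
Proof.
move=> pt; rewrite /aut_norm (big_morph Posz PoszD (erefl _)); apply: eq_bigr => i _.
rewrite wlen_signed ?positive_signed // big_ord_recl big_ord1 -heightDw.
by apply: eq_height => k; case: (@index2 ord0 (fintype.lift ord0 ord0) k isT) => ->.
Qed.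

Lemma aut_normV_positive theta : positive theta -> aut_norm theta^-1 = aut_norm theta.
Proof.
move=> pt; have [t' [pt' -> xt']] := positive_inv pt.
have Pn := @relabels_negate 2 ord0.
rewrite aut_norm_relabelr // aut_norm_relabell //.
apply/eqP; rewrite -eqz_nat !aut_norm_positive // exchange_big /=.
rewrite (reindex_inj rev_ord_inj) /=; apply/eqP/eq_bigr => i _.
by rewrite (reindex_inj rev_ord_inj) /=; apply: eq_bigr => j _; rewrite xt' !rev_ordK.
Qed.

(** These turn out to be the elements of least norm in their outer classes. *)
Definition standard psi := exists pi theta pi',
  [/\ relabels pi, positive theta, relabels pi' & psi = pi * theta * pi'].

Lemma relabels_invg_norm phi psi : relabels phi -> aut_norm (phi * psi)^-1 = aut_norm psi^-1.
Proof. by move=> P; rewrite invgM aut_norm_relabelr //; apply: relabelsV. Qed.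

Lemma aut_normV_standard psi : standard psi -> aut_norm psi^-1 = aut_norm psi.
Proof.
case=> pi [t [pi' [P pt P' ->]]]; rewrite aut_norm_relabelr // aut_norm_relabell //.
rewrite -mulgA relabels_invg_norm // invgM aut_norm_relabell; last exact: relabelsV.
exact: aut_normV_positive.
Qed.

End InverseNorm.

(** * Conjugation and first letters *)

Section Touching.
Local Open Scope group_scope.
Variable r : nat.
Implicit Types (x y z c : letter r) (g h k : free_group r) (phi : aut r).

(** For [g] nontrivial, these are the letters [c] such that something cancels in
[g ^ lett c]. *)
Definition touched c g :=
  (ohead (word g) == Some c) || (ohead (word g^-1) == Some c).

Lemma touchedV c g : touched c g^-1 = touched c g.
Proof. by rewrite /touched invgK orbC. Qed.

(** In terms of lengths, having a given first letter is visibly preserved by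
relabellings. *)
Lemma ohead_wlen c g :
  (ohead (word g) == Some c) = (wlen ((lett c)^-1 * g) < wlen g)%N.
Proof.
rewrite wlen_mulV [word (lett c)]/= /wlen; case: (word g) => //= z u.
rewrite (inj_eq (@Some_inj _)) eq_sym; case: eqP => _ /=; lia.
Qed.

Lemma touched_relabels phi c c' g : relabels phi -> phi (lett c) = lett c' ->
  touched c' (phi g) = touched c g.
Proof.
move=> P e; rewrite /touched -multV !ohead_wlen -e -multV -!gmulfM.
by rewrite !relabels_wlen.
Qed.

(** Nothing cancels at the two junctions of [h^-1 * g * h]. *)
Lemma wlen_untouchedJ c g h : g != 1 -> ohead (word h) = Some c ->
  ~~ touched c g -> wlen (g ^ h) = (wlen g + 2 * wlen h)%N.
Proof.
move=> g1 hc; rewrite negb_or => /andP[ngc ngVc].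
have gh : word (g * h) = word g ++ word h by rewrite word_mul_disjoint // hc.
rewrite conjgE wlen_mulV gh lcp_eq0 ?subn0.
  by rewrite [wlen (g * h)]/wlen gh size_cat -/(wlen g) -/(wlen h); lia.
rewrite hc eq_sym; case E: (word g) ngc => [|x u] //.
by case/eqP: g1; apply: wlen_eq0; rewrite /wlen E.
Qed.

Lemma ohead_wordV c g : ohead (word g^-1) = Some c -> last (flip c) (word g) = flip c.
Proof.
rewrite [word g^-1]/= /word_inv; case/lastP: (word g) => [//|u x].
by rewrite map_rcons rev_rcons last_rcons => -[<-]; rewrite flipK.
Qed.

(** The total exponent sum is invariant under conjugation and is, up to sign, the
length of a word with letters of one sign. *)
Lemma leq_wlen_signedJ s g h : signed s g -> (wlen g <= wlen (g ^ h))%N.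
Proof.
wlog -> : s g / s = true => [H|sg].
  case: s => sg; first exact: (H true).
  by rewrite -(wlenV g) -[wlen (g ^ h)]wlenV -conjVg; apply: (H true); rewrite ?signedV.
have := wlen_signed sg; rewrite -(heightJ _ _ h).
by have := @leq_height r (fun=> 1%R) (g ^ h) (fun=> isT); lia.
Qed.

End Touching.

(** * Rotating standard automorphisms *)

Section Rotation.
Local Open Scope group_scope.
Implicit Types (x y z c : letter 2) (g h : free_group 2) (i j k : 'I_2).
Implicit Types (phi psi theta : aut 2) (s : bool) (w : 'I_2 -> int).

Lemma word_transv_lett x y z : x.1 != y.1 -> z.2 = x.2 ->
  word (transv x y (lett z)) = if z == x then [:: x; y] else [:: z].
Proof.
move=> nxy szx; have [->|nzx] := eqVneq z x.
  rewrite transv_x // word_lettM //= andbT; apply: contraNneq nxy => ->.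
  by rewrite eqxx.
rewrite transv_other //; apply: contraNneq nzx => e; apply/eqP.
by case: z x e szx {nxy} => [? ?] [? ?] /= -> ->.
Qed.

Lemma word_transv x y z g : x.1 != y.1 -> x.2 = y.2 -> z.2 = x.2 -> signed x.2 g ->
  word (transv x y (lett z * g)) =
  (if z == x then [:: x; y] else [:: z]) ++ word (transv x y g).
Proof.
move=> nxy sxy szx sg; rewrite gmulfM (@word_signedM _ x.2) ?word_transv_lett //.
  by apply: signed_transv => //; rewrite signed_lett szx.
exact: signed_transv.
Qed.

Lemma ohead_transv x y g : x.1 != y.1 -> x.2 = y.2 -> signed x.2 g ->
  ohead (word (transv x y g)) = ohead (word g).
Proof.
move=> nxy sxy; elim/signed_word_ind => [|z h zs sh wzh _]; first by rewrite aut_1.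
by rewrite word_transv // wzh; case: eqP => [->|].
Qed.

Lemma last_transv x y g : x.1 != y.1 -> x.2 = y.2 -> signed x.2 g ->
  last y (word (transv x y g)) = y.
Proof.
move=> nxy sxy; elim/signed_word_ind => [|z h zs sh _ IH]; first by rewrite aut_1.
rewrite word_transv // last_cat; case: eqP => //= nzx.
case: (index2 z.1 nxy) => e; last by rewrite (_ : z = y) //; case: z y e zs {nxy nzx IH} sxy => [? ?] [? ?] /= -> -> ->.
by case: nzx; case: z x e zs {nxy sh sxy IH} => [? ?] [? ?] /= -> ->.
Qed.

(** For [g] a word in [x] and [y], the transvection replaces [x] by [xy]: the first
letter does not change and the last one becomes [y]. For the opposite sign pass
to the inverse. *)
Lemma touched_transv s x y c g : x.1 != y.1 -> x.2 = y.2 -> signed s g ->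
  touched c (transv x y g) -> c = flip y \/ c != flip x /\ touched c g.
Proof.
move=> nxy sxy; wlog -> : s g / s = x.2 => [H sg tg|sg].
  have [e|ne] := eqVneq s x.2; first exact: (H s).
  rewrite -[touched c g]touchedV; apply: (H (~~ s)); last by rewrite multV touchedV.
    by case: s x.2 ne {sg} => [] [].
  by rewrite signedV negbK.
case/orP=> /eqP E; [right | left].
  have E' := E; rewrite ohead_transv // in E'; rewrite /touched E' eqxx; split=> //.
  move: sg; rewrite /signed; case: (word g) E' => //= _ u [->] /andP[/eqP cs _].
  by apply: contraTneq isT => cx; move: cs; rewrite cx /=; case: x.2.
move/ohead_wordV: (E) (last_transv nxy sxy sg).
move: E; rewrite [word _^-1]/= /word_inv; case: (word _) => //= z u _ -> <-.
by rewrite flipK.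
Qed.

(** A common first letter, or the inverse of a common last letter, can be rotated
without leaving the positive monoid. If the last transvection [x -> xy] created
the common last letter [y], rotating it replaces this transvection by [x -> yx].
Otherwise the rotation is pushed through it and done, by induction, before. *)
Lemma positive_rotate theta c : positive theta ->
  (forall i, touched c (theta (gen i))) -> positive (theta * inner (lett c)).
Proof.
move=> pt; elim: pt c => [|t x y nxy sxy pt IH] c tc.
  have := tc ord0; have := tc ord_max; rewrite /touched /= !(inj_eq (@Some_inj _)).
  by move=> /orP[] /eqP <-.
have H i := touched_transv nxy sxy (positive_signed i pt) (tc i).
have [->|ncy] := eqVneq c (flip y).
  rewrite lettV -mulgA -transv_flip //; apply: positiveMr => //=.
  by rewrite sxy.
have ncx : c != flip x by case: (H ord0) => [e|[]//]; rewrite e eqxx in ncy.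
have tc' i : touched c (t (gen i)).
  by case: (H i) => [e|[]//]; rewrite e eqxx in ncy.
have rot := IH c tc'; case: (index2 c.1 nxy) => /lett_cases[] e;
  try by rewrite e eqxx in ncx ncy.
  rewrite e in rot *.
  have -> : t * transv x y * inner (lett x) =
            t * inner (lett x) * transv (flip x) (flip y).
    rewrite transv_flip // -!mulgA; congr (_ * _).
    by rewrite mulgA inner_aut transv_x // -mulgA -innerM mulgK.
  by apply: positiveMr; rewrite //= sxy.
rewrite e in rot *.
have -> : t * transv x y * inner (lett y) = t * inner (lett y) * transv x y.
  by rewrite -!mulgA inner_aut transv_other // eq_sym.
exact: positiveMr.
Qed.

Lemma standard_rotate psi c : standard psi ->
  (forall i, touched c (psi (gen i))) -> standard (psi * inner (lett c)).
Proof.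
case=> pi [t [pi' [P pt P' ->]]] tc.
have [c' ec'] := relabelsP c (relabelsV P').
have ec : pi' (lett c') = lett c by rewrite -ec' autK_inv.
exists pi, (t * inner (lett c')), pi'; split=> //; last first.
  by rewrite -!mulgA inner_aut ec.
apply: positive_rotate => // i.
have [z ez] := relabelsP (i, true) (relabelsV P).
have := tc z.1; rewrite -(touched_relabels _ P' ec).
rewrite (_ : gen i = pi (lett z)); last by rewrite -ez autK_inv.
by rewrite !autM (lett_gen z); case: z.2; rewrite ?multV ?touchedV.
Qed.

Lemma leq_wlen_standardJ psi i h : standard psi ->
  (wlen (psi (gen i)) <= wlen (psi (gen i) ^ h))%N.
Proof.
case=> pi [t [pi' [P pt P' ->]]]; have [z ez] := relabelsP (i, true) P.
rewrite !autM -[gen i]/(lett (i, true)) ez -(autK_inv pi' h) -autJ !(relabels_wlen _ P').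
rewrite lett_gen; case: z.2; rewrite ?multV ?conjVg 2?wlenV;
  exact: (leq_wlen_signedJ _ (positive_signed z.1 pt)).
Qed.

(** Conjugating by the letters of [g] one at a time, a letter either rotates both
images, and is absorbed, or leaves one of them untouched, and then that image
grows by two with this letter and each of the following ones. *)
Lemma standard_inner psi g : standard psi ->
  exists psi' g', [/\ standard psi', psi * inner g = psi' * inner g' &
    (aut_norm psi' + 2 * wlen g' <= aut_norm (psi * inner g))%N].
Proof.
elim/word_ind: g psi => [|c g rcg IH] psi sp.
  by exists psi, 1; split; rewrite // inner1 mulg1 /wlen /= muln0 addn0.
have [/forallP tc|] := boolP [forall i, touched c (psi (gen i))].
  have [psi' [g' []]] := IH _ (standard_rotate sp tc).
  by rewrite -mulgA -innerM; exists psi', g'.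
rewrite negb_forall => /existsP[i ntc]; exists psi, (lett c * g); split=> //.
rewrite /aut_norm (bigD1 i) // [leqRHS](bigD1 i) // addnAC !autM !innerE.
rewrite (@wlen_untouchedJ _ c) ?word_lettM // ?leq_add2l.
  by apply: leq_sum => j _; rewrite autM innerE leq_wlen_standardJ.
apply: contraTneq isT => /eqP; rewrite -(aut_1 psi).
by rewrite (inj_eq (bij_inj (aut_bij psi))) => /eqP/(congr1 (@wlen 2)).
Qed.

Definition outer_standard phi := exists psi g, standard psi /\ phi = psi * inner g.

Lemma outer_standardMr phi g : outer_standard phi -> outer_standard (phi * inner g).
Proof. by case=> psi [h [sp ->]]; exists psi, (h * g); rewrite innerM mulgA. Qed.

Lemma outer_standard_relabell pi phi : relabels pi -> outer_standard phi ->
  outer_standard (pi * phi).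
Proof.
move=> P [_ [h [[pi1 [t [pi2 [P1 pt P2 ->]]]] ->]]].
exists (pi * pi1 * t * pi2), h; rewrite !mulgA; split=> //.
by exists (pi * pi1), t, pi2; split=> //; apply: relabelsM.
Qed.

Lemma outer_standard_relabelr pi phi : relabels pi -> outer_standard phi ->
  outer_standard (phi * pi).
Proof.
move=> P [_ [h [[pi1 [t [pi2 [P1 pt P2 ->]]]] ->]]].
rewrite -mulgA inner_aut mulgA; apply: outer_standardMr.
exists (pi1 * t * (pi2 * pi)), 1; rewrite inner1 mulg1 mulgA; split=> //.
by exists pi1, t, (pi2 * pi); rewrite mulgA; split=> //; apply: relabelsM.
Qed.

Lemma positive_outer_standard theta : positive theta -> outer_standard theta.
Proof.
move=> pt; exists theta, 1; rewrite inner1 mulg1; split=> //.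
by exists 1, theta, 1; rewrite mul1g mulg1.
Qed.

(** In matrices: the product of an upper and a lower elementary matrix of opposite
signs is, up to a signed permutation, again elementary. It lets the
inverse of a positive transvection be absorbed by a positive automorphism. *)
Lemma relabels_swap x y : x.1 != y.1 -> x.2 = y.2 ->
  exists2 pi, relabels pi &
    transv x (flip y) * transv y x = pi * transv (flip x) (flip y).
Proof.
move=> nxy sxy; pose t := transv x (flip y) * transv y x * transv (flip x) y.
have tx : t (lett x) = lett (flip y).
  rewrite /t !autM transv_x // gmulfM lettV multV transv_x 1?eq_sym //.
  rewrite transv_other // invgM mulVKg -lettV transv_other // eq_sym.
  exact: nxy.
have ty : t (lett y) = lett x.
  rewrite /t !autM transv_other 1?eq_sym // transv_x 1?eq_sym // gmulfM.
  rewrite transv_other 1?eq_sym // -{2}[x]flipK lettV multV transv_x //.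
  by rewrite invgM mulVKg lettV invgK.
exists t; last by rewrite /t -(transvV (flip x)) mulgK.
move=> z; case: (index2 z.1 nxy) => /lett_cases[] ->;
  by rewrite ?lettV ?multV ?wlenV ?tx ?ty.
Qed.

(** When the signs of [x] and [y] differ, [transv x y] is the inverse of a positive
transvection. Up to inner automorphisms it cancels the leftmost factor of [theta]
or is exchanged with it by [relabels_swap]; if there is none, changing the sign
of one generator makes it positive. *)
Lemma outer_standard_transv_positive x y theta : x.1 != y.1 -> positive theta ->
  outer_standard (transv x y * theta).
Proof.
move=> nxy pt; have [sxy|dxy] := eqVneq x.2 y.2.
  apply/positive_outer_standard/positiveM => //; exact: positive_transv.
have sxy : x.2 = (flip y).2 by rewrite /=; case: x.2 y.2 dxy => [] [].
elim/positive_left_ind: pt => [|u v t nuv suv pt _].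
  have [x' ex] := relabelsP x (@relabels_negate 2 y.1).
  rewrite mulg1 -[transv x y]mulg1 -(negateK y.1) mulgA.
  rewrite (@transv_relabels _ x y x (flip y) (relabels_negate y.1)) // ?negate_lett ?(negPf nxy) ?addbF.
  - apply: outer_standard_relabelr; first exact: relabels_negate.
    apply: outer_standard_relabell; first exact: relabels_negate.
    exact/positive_outer_standard/positive_transv.
  - by case: (x).
  - by rewrite eqxx addbT.
have flipped a b : a.1 != b.1 ->
    outer_standard (transv x y * (transv a b * t)) ->
    outer_standard (transv x y * (transv (flip a) (flip b) * t)).
  move=> nab H; rewrite transv_flip // -[_ * inner _ * t]mulgA inner_aut !mulgA.
  by apply: outer_standardMr; rewrite -mulgA.
have cancelled : outer_standard (transv x y * (transv x (flip y) * t)).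
  by rewrite mulgA -transvV mulgV mul1g; apply: positive_outer_standard.
have swapped : outer_standard (transv x y * (transv (flip y) x * t)).
  have nxy' : x.1 != (flip y).1 by [].
  have [pi P] := relabels_swap nxy' sxy; rewrite flipK mulgA => ->.
  rewrite -mulgA; apply: outer_standard_relabell => //.
  apply/positive_outer_standard/positiveM => //; apply: positive_transv => //=.
  by rewrite sxy /= negbK.
case: (index2 u.1 nxy) => eu; case: (index2 v.1 nxy) => ev;
  try by rewrite eu ev eqxx in nuv.
- case: (lett_cases eu) (lett_cases ev) => Eu [] Ev; rewrite Eu Ev in suv *.
  + by move: dxy; rewrite -suv eqxx.
  + exact: cancelled.
  + by have := flipped x (flip y) nxy cancelled; rewrite flipK.
  + by move: dxy suv => /=; case: x.2 y.2 => [] [].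
- case: (lett_cases eu) (lett_cases ev) => Eu [] Ev; rewrite Eu Ev in suv *.
  + by move: dxy; rewrite -suv eqxx.
  + have := flipped (flip y) x _ swapped; rewrite flipK; apply.
    by rewrite eq_sym.
  + exact: swapped.
  + by move: dxy suv => /=; case: x.2 y.2 => [] [].
Qed.

Lemma outer_standard_transvl x y phi : x.1 != y.1 -> outer_standard phi ->
  outer_standard (transv x y * phi).
Proof.
move=> nxy [_ [h [[pi1 [t [pi2 [P1 pt P2 ->]]]] ->]]].
have [x' ex] := relabelsP x P1; have [y' ey] := relabelsP y P1.
rewrite !mulgA (transv_relabels P1 nxy ex ey); apply: outer_standardMr.
apply: outer_standard_relabelr => //; rewrite -mulgA.
apply: outer_standard_relabell => //; apply: outer_standard_transv_positive => //.
exact: relabels_index nxy.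
Qed.

End Rotation.

(** * Nielsen reduced bases *)

Section NielsenReduced.
Local Open Scope group_scope.
Variable r : nat.
Implicit Types (x y z c : letter r) (g h k : free_group r) (phi : aut r).

Lemma word_inv_drop n (s : seq (letter r)) :
  word_inv (drop n (word_inv s)) = take (size s - n) s.
Proof.
rewrite /word_inv drop_rev map_rev revK size_map map_take -map_comp map_id_in //.
by move=> x _ /=; rewrite flipK.
Qed.

(** In any product of three factors that are images of letters and do not cancel
formally, a part of the middle factor survives. *)
Definition nielsen_reduced phi := forall x1 y x2, x1 != y -> x2 != flip y ->
  (lcp (word (phi (lett x1))) (word (phi (lett y))) +
   lcp (word (phi (lett x2))) (word (phi (lett (flip y)))) < wlen (phi (lett y)))%N.

(** A prefix of the image of the first letter survives, long enough to block the
cancellation with any further factor put in front; this is the invariant that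
makes the induction on the word work. *)
Lemma nielsen_reduced_prefix phi g y u : nielsen_reduced phi -> word g = y :: u ->
  exists m v, [/\ word (phi g) = take m (word (phi (lett y))) ++ v,
    (m <= wlen (phi (lett y)))%N,
    forall x, x != y -> (lcp (word (phi (lett x))) (word (phi (lett y))) < m)%N &
    u != [::] -> (1 < wlen (phi g))%N].
Proof.
move=> N; elim/word_ind: g y u => // x g rxg IH y u.
rewrite word_lettM // => -[exy eu]; rewrite -{y}exy -{u}eu in rxg *.
case E: (word g) => [|z u].
  have -> : g = 1 by apply: val_inj.
  exists (wlen (phi (lett x))), [::]; rewrite mulg1 cats0 take_size; split=> // y nyx.
  by apply: leq_ltn_trans (N y x x nyx _); rewrite ?leq_addr // eq_sym flip_neq.
have nzx : z != flip x by move: rxg; rewrite E /= => /andP[].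
have [m [v [wg ml lm _]]] := IH _ _ E.
have nxz : flip x != z by rewrite eq_sym.
have K : lcp (word (phi (lett (flip x)))) (word (phi g)) =
         lcp (word (phi (lett (flip x)))) (word (phi (lett z))).
  by rewrite wg lcp_take // lm.
have kx := N _ _ _ (flip_neq x) nzx; rewrite [lcp (word (phi (lett z))) _]lcpC in kx.
have := lm _ nxz; set k := lcp _ (word (phi (lett z))) in K kx * => km.
have phixg : word (phi (lett x * g)) =
    take (wlen (phi (lett x)) - k) (word (phi (lett x))) ++ drop k (word (phi g)).
  rewrite gmulfM -{1}[x]flipK lettV multV word_mulV K; congr (_ ++ _).
  by rewrite lettV multV word_inv_drop.
have mg : (m <= wlen (phi g))%N by rewrite /wlen wg size_cat size_take; move: ml; rewrite /wlen; case: ltnP; lia.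
exists (wlen (phi (lett x)) - k)%N, (drop k (word (phi g))); split=> //.
- exact: leq_subr.
- by move=> y nyx; have := N _ _ _ nyx nzx; rewrite [lcp (word (phi (lett z))) _]lcpC -/k; lia.
move=> _; rewrite /wlen phixg size_cat size_drop size_takel; last by rewrite leq_subr.
by move: kx mg; rewrite /wlen; lia.
Qed.

(** A word of length at least two has an image of length at least two, so letters
are images of letters. *)
Lemma nielsen_reduced_relabels phi : nielsen_reduced phi -> relabels phi.
Proof.
move=> N; rewrite -[phi]invgK; apply: relabelsV => c.
have e := autK_inv phi (lett c).
case E: (word (phi^-1 (lett c))) => [|y [|z u]]; last first.
- have [m [v [_ _ _ /(_ isT)]]] := nielsen_reduced_prefix N E.
  by rewrite e.
- by rewrite /wlen E.
have e1 : phi^-1 (lett c) = 1 by apply: val_inj.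
by move: e; rewrite e1 aut_1 => /(congr1 (@wlen r)).
Qed.

Lemma word_catP g u v : word g = u ++ v ->
  exists h k, [/\ word h = u, word k = v & g = h * k].
Proof.
move=> e; have := free_group_reduced g; rewrite /reduced e => /cat_sorted2[ru rv].
exists (FreeGroup (ru : reduced u)), (FreeGroup (rv : reduced v)); split=> //.
apply: val_inj; rewrite /= -[RHS]/(word_mul u v) word_mul_cat_reduced // -?e //.
exact: free_group_reduced.
Qed.

End NielsenReduced.

(** * Reducing a basis of the free group of rank two *)

Section Generation.
Local Open Scope group_scope.
Implicit Types (x y z c : letter 2) (g h : free_group 2) (i j k : 'I_2).
Implicit Types (phi psi theta : aut 2) (s : bool) (w : 'I_2 -> int).

Definition nielsen_minimal phi := forall x y h, x.1 != y.1 ->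
  (aut_norm phi <= aut_norm (transv x y * phi * inner h))%N.

(** Otherwise multiplying one image by the other would shorten the basis. *)
Lemma minimal_half_cancel phi x y : nielsen_minimal phi -> x.1 != y.1 ->
  (2 * lcp (word (phi (lett x))) (word (phi (lett y))) <= wlen (phi (lett y)))%N.
Proof.
move=> M nxy; have := M (flip x) y 1 nxy; rewrite inner1 mulg1.
have nxy' : (flip x).1 != y.1 by [].
rewrite !(aut_norm2 _ nxy') !autM transv_x // transv_other 1?eq_sym //.
rewrite gmulfM lettV multV wlen_mulV wlenV.
have := leq_lcp (word (phi (lett x))) (word (phi (lett y))).
have := leq_lcp (word (phi (lett y))) (word (phi (lett x))); rewrite lcpC /wlen.
move: (lcp _ _) (size _) (size _) => k m n; lia.
Qed.

(** By [minimal_half_cancel] a failure means that exactly half of [u], the image of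
[y], cancels on each side, against images of letters of the other index. If these
are the same element, [u] and [u^-1] agree on half of their length, against
[lcpV_lt]. If they are [v] and [v^-1], then [u = pq] and [v = pmq], and the basis
[u, v u^-1] conjugated by [p] is [qp, m], which is shorter. *)
Lemma minimal_nielsen_reduced phi : nielsen_minimal phi -> nielsen_reduced phi.
Proof.
move=> M x1 y x2 n1 n2.
have self z : (2 * lcp (word (phi (lett z))) (word (phi (lett (flip z)))) < wlen (phi (lett z)))%N.
  rewrite lettV multV lcpV_lt //; apply: contraTneq isT; rewrite -(aut_1 phi).
  by move/(bij_inj (aut_bij phi))/(congr1 (@wlen 2)).
have half z z' := @minimal_half_cancel phi z z' M.
have LV : wlen (phi (lett (flip y))) = wlen (phi (lett y)) by rewrite lettV multV wlenV.
have self1 := self y; have [e1|d1] := eqVneq x1.1 y.1.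
  have -> : x1 = flip y by case: (lett_cases e1) n1 => // ->; rewrite eqxx.
  rewrite lcpC; have [e2|d2] := eqVneq x2.1 y.1.
    have -> : x2 = y by case: (lett_cases e2) n2 => // ->; rewrite eqxx.
    lia.
  by have := half x2 (flip y) d2; rewrite LV; lia.
have H1 := half _ _ d1; have [e2|d2] := eqVneq x2.1 y.1.
  have -> : x2 = y by case: (lett_cases e2) n2 => // ->; rewrite eqxx.
  lia.
have H2 := half x2 (flip y) d2; rewrite LV in H2.
set a := lcp (word (phi (lett x1))) _ in H1 *.
set b := lcp (word (phi (lett x2))) _ in H2 *.
rewrite ltnNge; apply/negP => tie.
have [ea eb] : (2 * a = wlen (phi (lett y)) /\ b = a)%N by lia.
have ta : take a (word (phi (lett x1))) = take a (word (phi (lett y))) := take_lcp _ _.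
have tb : take a (word (phi (lett x2))) = take a (word (phi (lett (flip y)))).
  by rewrite -eb; apply: take_lcp.
have e12 : x1.1 = x2.1 by case: (index2 x1.1 d2) => // e; rewrite e eqxx in d1.
case: (lett_cases e12) => E.
  have : (a <= lcp (word (phi (lett y))) (word (phi (lett (flip y)))))%N.
    apply: lcp_geP; rewrite -/(wlen _) ?LV; try lia.
    by rewrite -ta -tb E.
  lia.
have L1 := half y x1 ltac:(by rewrite eq_sym); rewrite lcpC -/a in L1.
pose Y := word (phi (lett y)); pose Z := word (phi (lett x1)).
have eQ : drop (size Z - a) Z = drop a Y.
  move: tb; rewrite (_ : x2 = flip x1); last by rewrite E flipK.
  rewrite !lettV !multV /= /word_inv !take_rev !size_map -!map_drop.
  move=> /(can_inj revK)/(inj_map (can_inj (@flipK 2))) ->.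
  by congr drop; rewrite -/(wlen _) -ea mul2n -addnn addnK.
have eZ : Z = take a Y ++ (take (size Z - 2 * a) (drop a Z) ++ drop a Y).
  rewrite -eQ -[take a Y]ta -{1}(cat_take_drop a Z); congr (_ ++ _).
  rewrite -{1}(cat_take_drop (size Z - 2 * a) (drop a Z)) drop_drop; congr (_ ++ drop _ _).
  by move: L1; rewrite /wlen -/Z; lia.
have [p [q [wp wq ey]]] := word_catP (esym (cat_take_drop a Y)).
have [p' [mq [wp' wmq ez]]] := word_catP eZ.
have [m [q' [wm wq' emq]]] := word_catP wmq.
have ep : p' = p by apply: val_inj; rewrite /= wp' wp.
have eq : q' = q by apply: val_inj; rewrite /= wq' wq.
have := M x1 (flip y) p d1; rewrite (aut_norm2 _ d1) leqNgt => /negP; apply.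
rewrite (aut_norm2 _ d1) !autM !innerE transv_x // gmulfM transv_other 1?eq_sym //.
rewrite lettV multV ez emq ep eq ey !conjgE.
have -> : p^-1 * (p * (m * q) * (p * q)^-1 * p) = m.
  by rewrite invgM -!mulgA mulKg mulVg mulg1 mulgV mulg1.
have -> : p^-1 * (p * q * p) = q * p by rewrite -mulgA mulKg.
have lenM : (wlen m + 2 * a <= wlen (phi (lett x1)))%N.
  rewrite [wlen m]/wlen wm; move: L1; rewrite /wlen -/Z => L1.
  by rewrite size_take size_drop; case: ifP; lia.
have leny : (wlen (q * p) <= wlen (phi (lett y)))%N.
  by apply: leq_trans (leq_wlenM _ _) _; rewrite addnC /wlen wq wp -size_cat cat_take_drop.
have posy : (0 < wlen (phi (lett y)))%N by apply: leq_ltn_trans self1.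
rewrite ez emq ep eq in lenM; rewrite ey in leny posy ea; lia.
Qed.

(** Induction on the norm: a basis that cannot be shortened consists of letters. *)
Lemma all_outer_standard phi : outer_standard phi.
Proof.
have [n] := ubnP (aut_norm phi); elim: n phi => // n IHn phi /ltnSE len.
have [[x [y [h [nxy lt]]]]|M] := boolp.pselect (exists x y h, x.1 != y.1 /\
    (aut_norm (transv x y * phi * inner h) < aut_norm phi)%N).
  have /IHn H : (aut_norm (transv x y * phi * inner h) < n)%N by exact: leq_trans lt len.
  have -> : phi = transv x (flip y) * (transv x y * phi * inner h) * inner h^-1.
    by rewrite -!mulgA -innerM mulgV inner1 mulg1 -transvV mulKg.
  by apply/outer_standardMr/outer_standard_transvl.
have P : relabels phi.
  apply/nielsen_reduced_relabels/minimal_nielsen_reduced => x y h nxy.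
  by rewrite leqNgt; apply/negP => lt; apply: M; exists x, y, h.
rewrite -[phi]mulg1; apply: outer_standard_relabell => //.
exact: positive_outer_standard positive1.
Qed.

End Generation.

(** * The gap functions *)

Section Gap2.
Local Open Scope group_scope.
Implicit Types (x y z c : letter 2) (g h : free_group 2) (i j k : 'I_2).
Implicit Types (phi psi theta : aut 2) (w : 'I_2 -> int).

Lemma standard_decomposition phi : exists psi g,
  [/\ standard psi, phi = psi * inner g & (aut_norm psi + 2 * wlen g <= aut_norm phi)%N].
Proof.
have [psi [g [sp ->]]] := all_outer_standard phi.
by have [psi' [g' [sp' e le]]] := standard_inner g sp; exists psi', g'.
Qed.

Lemma aut_mul_innerV psi g h : (psi * inner g)^-1 h = psi^-1 (h ^ g^-1).
Proof.
rewrite invgM (_ : (inner g)^-1 = inner g^-1) //.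
by apply: (mulgI (inner g)); rewrite mulgV -innerM mulgV inner1.
Qed.

Lemma leq_wlenJ g h : (wlen (g ^ h) <= wlen g + 2 * wlen h)%N.
Proof.
rewrite conjgE; apply: leq_trans (leq_wlenM _ _) _; rewrite wlenV.
by apply: leq_trans (leq_add (leqnn _) (leq_wlenM g h)) _; lia.
Qed.

Lemma wlen_aut_gt0 phi x : (0 < wlen (phi (lett x)))%N.
Proof.
rewrite lt0n; apply: contraTneq isT => /wlen_eq0; rewrite -(aut_1 phi).
by move/(bij_inj (aut_bij phi))/(congr1 (@wlen 2)).
Qed.

(** With [k] the norm of [psi^-1], each image of a letter under [psi^-1] has length
at most [k - 1], since the other image is not trivial. Both images of the inverse
are thus conjugates by a word of length at most [(k - 1) |g|]. The last letter of
[g] commutes with one of the generators, and what this saves absorbs the length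
[k] of the words that are conjugated. *)
Lemma aut_normV_inner_bound psi g : g != 1 ->
  (aut_norm (psi * inner g)^-1 <= 4 * (wlen g * (aut_norm psi^-1).-1))%N.
Proof.
move=> g1; case/lastP E: (word g) => [|u c].
  by case/eqP: g1; apply: val_inj.
have [h [l [wh wl eg]]] := word_catP (etrans E (esym (cats1 u c))).
have el : l = lett c by apply: val_inj.
have len_g : wlen g = (wlen h).+1 by rewrite /wlen E wh size_rcons.
pose d : letter 2 := (rev_ord c.1, true).
have ncd : c.1 != d.1.
  by rewrite -(inj_eq val_inj) /=; case: (c.1) => [[|[|]]].
rewrite !(aut_norm2 _ ncd) !aut_mul_innerV eg el.
have -> : lett c ^ (h * lett c)^-1 = lett c ^ h^-1.
  by rewrite invgM conjgM; congr (_ ^ _); rewrite conjgE invgK mulgV mulg1.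
rewrite -el -eg el len_g; set A := wlen (psi^-1 (lett c)); set B := wlen (psi^-1 (lett d)).
have A0 : (0 < A)%N := wlen_aut_gt0 _ _; have B0 : (0 < B)%N := wlen_aut_gt0 _ _.
have K x : (wlen (psi^-1 (lett x)) <= (A + B).-1)%N.
  rewrite (wlen_aut_lett psi^-1 x); case: (index2 x.1 ncd) => ->.
    by rewrite -(wlen_aut_lett psi^-1 c) -/A; lia.
  by rewrite -(wlen_aut_lett psi^-1 d) -/B; lia.
have lenh := leq_wlen_aut h K.
have H1 : (wlen (psi^-1 (lett c ^ h^-1)%g) <= A + 2 * ((A + B).-1 * wlen h))%N.
  rewrite autJ; apply: leq_trans (leq_wlenJ _ _) _.
  by rewrite multV wlenV leq_add2l leq_mul2l.
have H2 : (wlen (psi^-1 (lett d ^ g^-1)%g) <= B + 2 * (A + (A + B).-1 * wlen h))%N.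
  rewrite autJ; apply: leq_trans (leq_wlenJ _ _) _.
  rewrite multV wlenV leq_add2l leq_mul2l orFb eg el gmulfM.
  by apply: leq_trans (leq_wlenM _ _) _; rewrite addnC leq_add2l.
apply: leq_trans (leq_add H1 H2) _.
by move: lenh => _; nia.
Qed.

Lemma alpha_upper n : (4 <= n)%N -> (2 * alpha 2 n <= (n - 1) ^ 2)%N.
Proof.
move=> n4; have norm1 : (aut_norm (1 : aut 2) <= n)%N.
  by rewrite (@aut_norm2 1 (ord0, true) (ord_max, true)) //; apply: leq_trans n4.
have [[phi le <-] _] := alphaP norm1.
have [psi [g [sp ephi dec]]] := standard_decomposition phi; subst phi.
have nV := aut_normV_standard sp.
have [->|g1] := eqVneq g 1.
  rewrite inner1 mulg1 nV; have : (aut_norm psi <= n)%N by lia.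
  by move=> kn; nia.
have := aut_normV_inner_bound psi g1; rewrite nV.
move: dec le; move: (aut_norm psi) (leq_rank_norm psi) (wlen g) => k k2 l dec le.
have : (k.-1 + 2 * l <= n - 1)%N by lia.
move: k.-1 => K leK bd; apply: leq_trans (leq_mul (leqnn 2) bd) _.
apply: (@leq_trans ((K + 2 * l) ^ 2)); last by rewrite leq_exp2r.
(* The difference of the two sides is [(K - 2 * l) ^ 2]. *)
by have := (nat_Cauchy K (2 * l)).1; rewrite sqrnD; nia.
Qed.

Lemma transvX_y x y m : x.1 != y.1 -> (transv x y ^+ m) (lett y) = lett y.
Proof.
move=> nxy; elim: m => // m IHm; rewrite expgS autM transv_other //.
by rewrite eq_sym.
Qed.

Lemma transvX_x x y m : x.1 != y.1 ->
  (transv x y ^+ m) (lett x) = lett x * lett y ^+ m.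
Proof.
move=> nxy; elim: m => [|m IHm]; first by rewrite mulg1.
rewrite expgS autM transv_x // gmulfM IHm transvX_y //.
by rewrite expgSr mulgA.
Qed.

Lemma transvXV x y m : (transv x y ^+ m)^-1 = transv x (flip y) ^+ m.
Proof. by rewrite -transvV expVgn. Qed.

Lemma leq_wlenX g n : (wlen (g ^+ n) <= n * wlen g)%N.
Proof.
elim: n => // n IHn; rewrite expgS mulSn.
by apply: leq_trans (leq_wlenM _ _) _; rewrite leq_add2l.
Qed.

Let a : letter 2 := (ord0, true).
Let b : letter 2 := (ord_max, true).

Let nba : b.1 != a.1. Proof. by []. Qed.

Lemma leq_aut_norm_transvX m y : y.1 = a.1 -> (aut_norm (transv b y ^+ m) <= m.+2)%N.
Proof.
move=> ya; have nby : b.1 != y.1 by rewrite ya.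
rewrite (aut_norm2 _ nby) transvX_x // transvX_y //.
have := leq_wlenM (lett b) (lett y ^+ m); have := leq_wlenX (lett y) m.
by rewrite /wlen /=; lia.
Qed.

Lemma beta_upper n : (1 < n)%N -> (beta 2 n <= n)%N.
Proof.
move=> n1; have norm1 : (out_norm (out_class (1 : aut 2)%g) <= n)%N.
  apply: leq_trans ((out_normP _).2 (1 : aut 2)%g _) _; first exact: inn_coset_refl.
  exact: leq_trans (@leq_aut_norm_transvX 0 a erefl) n1.
have [[Psi le <-] _] := betaP norm1; apply: leq_trans le.
have [[phi Pphi <-] _] := out_normP Psi.
have [psi [g [sp e dec]]] := standard_decomposition phi.
have Ppsi : out_set Psi psi.
  have [theta eT] := out_classP Psi; rewrite eT in Pphi *.
  rewrite /= in Pphi *; rewrite -(inn_coset_eq Pphi); apply/inn_cosetP.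
  by exists g^-1; rewrite e -mulgA -innerM mulgV inner1 mulg1.
apply: leq_trans ((out_normP Psi^-1).2 psi^-1 _) _; first by exists psi.
by rewrite aut_normV_standard //; lia.
Qed.

(** Every conjugate of [b a^-m] has length at least [m + 1], by the weights [1] on
[b] and [-1] on [a]. *)
Lemma beta_lower m : (m.+2 <= beta 2 m.+2)%N.
Proof.
pose t := transv b a ^+ m.
have le : (out_norm (out_class t) <= m.+2)%N.
  apply: leq_trans ((out_normP _).2 t _) (leq_aut_norm_transvX m (erefl a.1)).
  exact: inn_coset_refl.
have [_] := betaP le; apply: leq_trans.
rewrite [(out_class t)^-1]out_invE.
have [[phi /inn_cosetP[g ->] <-] _] := out_normP (out_class t^-1).
have nby : b.1 != (flip a).1 by [].
rewrite (aut_norm2 _ nby) !autM !innerE /t transvXV transvX_x // transvX_y //.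
pose w (i : 'I_2) : int := if i == ord0 then (-1)%R else 1%R.
have w1 i : (`|w i| <= 1)%N by rewrite /w; case: eqP.
have := leq_height (lett (flip a) ^ g) w1.
have := leq_height ((lett b * lett (flip a) ^+ m) ^ g) w1.
rewrite !heightJ heightM heightX !height_lett.
have [-> ->] : letter_height w b = 1%R /\ letter_height w (flip a) = 1%R by [].
rewrite -[(1 *+ m)%R]/(m%:R)%R natz -PoszD absz_nat => leb lea.
by apply: leq_trans (leq_add lea leb) _; rewrite addnC.
Qed.

Lemma word_lettX x n : word (lett x ^+ n) = nseq n x /\ signed x.2 (lett x ^+ n).
Proof.
elim: n => // n [wn sn]; rewrite expgS; split.
  by rewrite (word_signedM _ sn) ?signed_lett // wn.
by apply: signedM; rewrite ?signed_lett.
Qed.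

(** For [l] positive the conjugator [V] starts with [b], while [a] and [a^-1 b a^(m+1)], as well as
their inverses, start with [a] or [a^-1], so that nothing cancels in the
conjugates. *)
Lemma wlen_alpha_witness m l (V := (lett b * lett a ^+ m) ^+ l) :
  (4 * (l * m.+1) + m + 4 <=
   wlen (lett a ^ V) + wlen (((lett a)^-1 * (lett b * lett a ^+ m.+1)) ^ V))%N.
Proof.
set X := (lett a)^-1 * _.
have [wam sam] := word_lettX a m; have [wam1 sam1] := word_lettX a m.+1.
have wB : word (lett b * lett a ^+ m) = b :: nseq m a.
  by rewrite (@word_signedM _ true) // wam.
have sB : signed true (lett b * lett a ^+ m) by apply: signedM.
have sV : signed true V.
  by rewrite /V; elim: (l) => // n IH; rewrite expgS; apply: signedM.
have lV : (l * m.+1 <= wlen V)%N.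
  rewrite /V; elim: (l) => // n IH; rewrite expgS /wlen (@word_signedM _ true) //.
    by rewrite size_cat wB /= size_nseq mulSn leq_add2l.
  by elim: (n) => // n' IH'; rewrite expgS; apply: signedM.
have wX : word X = [:: flip a, b, a & nseq m a].
  have wb : word (lett b * lett a ^+ m.+1) = [:: b, a & nseq m a].
    by rewrite (@word_signedM _ true) // wam1.
  rewrite /X -lettV word_lettM wb //.
  by have := free_group_reduced (lett b * lett a ^+ m.+1); rewrite wb.
have tX : ~~ touched b X.
  rewrite negb_or wX; apply/andP; split=> //; apply/negP => /eqP /ohead_wordV.
  rewrite wX -[X in last _ X]/([:: flip a; b] ++ nseq m.+1 a) last_cat.
  by elim: (m).
have ta : ~~ touched b (lett a) by [].
have conj g : ~~ touched b g -> g != 1 -> (wlen g + 2 * (l * m.+1) <= wlen (g ^ V))%N.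
  move=> tg g1; have [V1|V1] := eqVneq V 1.
    by rewrite V1 conjg1; move: lV; rewrite V1 leqn0 => /eqP ->; rewrite addn0.
  rewrite (wlen_untouchedJ g1 _ tg) ?leq_add2l ?leq_mul2l //.
  move: V1; rewrite /V; case: (l) => [|n] V1; first by case/eqP: V1.
  rewrite expgS (@word_signedM _ true) ?wB //.
  by elim: (n) => // n' IH'; rewrite expgS; apply: signedM.
have lX : wlen X = m.+3 by rewrite /wlen wX /= size_nseq.
have X1 : X != 1 by apply/eqP => X1; rewrite X1 in lX.
have cX := conj X tX X1; have ca := conj (lett a) ta isT.
apply: leq_trans (leq_add ca cX); rewrite lX.
by rewrite /wlen /=; lia.
Qed.

(** The values [l = (n - 6) / 8] and [m = n - 4 l - 6] make [m] and [4 l] nearly equal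
under the constraint [m + 4 l + 6 <= n]. *)
Lemma alpha_lower n : (10 <= n)%N -> (n ^ 2 + 168 <= 4 * alpha 2 n + 24 * n)%N.
Proof.
move=> n10; pose l := ((n - 6) %/ 8)%N; pose d := ((n - 6) %% 8)%N.
have en : n = (8 * l + d + 6)%N by have := divn_eq (n - 6) 8; rewrite -/l -/d; lia.
have d8 : (d < 8)%N by apply: ltn_pmod.
pose m := (4 * l + d)%N.
pose g := lett b ^- l * (lett a)^-1.
pose phi := transv b (flip a) ^+ m * inner g.
have nphi : (aut_norm phi <= n)%N.
  have lg : (wlen g <= l.+1)%N.
    apply: leq_trans (leq_wlenM _ _) _; rewrite !wlenV [wlen (lett a)]/= addn1 ltnS.
    by apply: leq_trans (leq_wlenX _ _) _; rewrite [wlen _]/= muln1.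
  have := @leq_aut_norm_transvX m (flip a) erefl.
  rewrite /phi !(aut_norm2 _ nba) !autM !innerE.
  have := leq_wlenJ ((transv b (flip a) ^+ m) (lett a)) g.
  have := leq_wlenJ ((transv b (flip a) ^+ m) (lett b)) g.
  by move: (wlen _) (wlen _) (wlen _) (wlen _) (wlen _) lg => ? ? ? ? ?; lia.
have [_ le] := alphaP nphi.
have eV : aut_norm phi^-1 = (wlen (lett a ^ ((lett b * lett a ^+ m) ^+ l)) +
    wlen (((lett a)^-1 * (lett b * lett a ^+ m.+1)) ^ ((lett b * lett a ^+ m) ^+ l)))%N.
  rewrite (aut_norm2 _ nba) addnC /phi !aut_mul_innerV transvXV flipK !autJ.
  have -> : (transv b a ^+ m) g^-1 = lett a * (lett b * lett a ^+ m) ^+ l.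
    rewrite /g invgM !invgK gmulfM transvX_y // autX transvX_x //.
  rewrite transvX_x // transvX_y // !conjgM; congr (wlen (_ ^ _) + wlen (_ ^ _))%N.
  by rewrite conjgE -mulgA -expgSr.
apply: leq_trans (_ : 4 * (4 * (l * m.+1) + m + 4) + 24 * n <= _)%N; last first.
  by rewrite leq_add2r leq_mul2l; apply: leq_trans le; rewrite eV wlen_alpha_witness.
rewrite en /m; clearbody l d; clear -d8 n10 en; nia.
Qed.

Lemma beta_0 : beta 2 0 = 0%N.
Proof.
rewrite /beta (_ : [set Phi : out 2 | (out_norm Phi <= 0)%N]%classic = set0).
  by rewrite image_set0 set_max0.
apply/seteqP; split=> // Phi /=; have [[phi _ <-] _] := out_normP Phi.
by rewrite leqn0 => /eqP e; have := leq_rank_norm phi; rewrite e.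
Qed.

End Gap2.

Import Order.TTheory GRing.Theory Num.Theory.
Local Open Scope ring_scope.

Theorem theorem1p7 :
  (forall n : nat, (4 <= n)%N ->
     (alpha 2 n)%:R <= (n%:R - 1) ^+ 2 / 2%:R :> rat) /\
  (forall n : nat, (10 <= n)%N ->
     n%:R ^+ 2 / 4%:R - 6%:R * n%:R + 42%:R <= (alpha 2 n)%:R :> rat) /\
  (forall n : nat, n <> 1%N -> beta 2 n = n).
Proof.
split; [|split] => n.
- move=> n4; have := alpha_upper n4; rewrite -(ler_nat rat) natrM natrX natrB.
    by move=> H; lra.
  exact: leq_trans n4.
- by move=> /alpha_lower; rewrite -(ler_nat rat) 2!natrD (natrX _ n 2) (natrM _ 4) (natrM _ 24) => H; lra.
case: n => [|[|n]] // _; first exact: beta_0.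
by apply/eqP; rewrite eqn_leq beta_upper // beta_lower.
Qed.
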